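(* Let $W$ be a $d$-dimensional Wiener process with respect to a filtration $(\mathcal F_t)$, $(\beta_t)_{t\ge0}$ an $\mathbb R^d$-valued progressively measurable process with $\int_0^t|\beta_s|ds<\infty$ a.s. for all $t$, $\xi_t=\int_0^t\beta_sds+W_t$, and $\mu_\xi,\mu_W$ the laws of $\xi,W$ on $C([0,\infty),\mathbb R^d)$. For $\delta\in(0,1)$ put $M_\delta:=\mathbb E\big(\int_0^\infty|\beta_t|^2dt\big)^\delta$. Then for any $\delta\in(0,1)$: $$d_{TV}(\mu_\xi,\mu_W)\le2^{(1-\delta)/(1+\delta)}M_\delta^{1/(1+\delta)},$$ $$d_{TV}(\mu_\xi,\mu_W)\le1-\frac16\min\Big(\frac18,\ e^{-(2^{2-\delta}M_\delta)^{1/\delta}}\Big),$$ and for any measurable $A\subset C([0,\infty),\mathbb R^d)$ and any $N>1$, $$\mu_W(A)\ge\frac1N\Big(\mu_\xi(A)-\frac{2^{1-\delta}M_\delta}{(\log N)^\delta}-\frac{\log2}{\log N}\Big).$$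
   Context: $d_{TV}(\mu,\nu)=\sup_A|\mu(A)-\nu(A)|$. The bounds are understood trivially when $M_\delta=\infty$. *)

(* Defs.v *)
From HB Require Import structures.
From mathcomp Require Import all_boot all_order all_algebra.
From mathcomp Require Import all_classical all_reals all_analysis.
From mathcomp Require Import normal_distribution.
Set Implicit Arguments. Unset Strict Implicit. Unset Printing Implicit Defensive.
Import Order.TTheory GRing.Theory Num.Theory.
Import numFieldNormedType.Exports.
Local Open Scope classical_set_scope.
Local Open Scope ring_scope.

Definition filtration {R : realType} {dO : measure_display} {Omega : measurableType dO}
  (F : R -> set (set Omega)) : Prop :=
  [/\ forall t, 0 <= t -> sigma_algebra setT (F t),
      forall t, 0 <= t -> F t `<=` measurable
    & forall s t, 0 <= s -> s <= t -> F s `<=` F t].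

(* W = (W_1,...,W_n) (component processes W i t omega) is an n-dimensional
   Wiener process w.r.t. the filtration F on (Omega, P):
   adapted, W_0 = 0, continuous paths on [0,oo), and for 0 <= s < t the
   increment W_t - W_s is independent of F_s with law N(0, (t-s) I_n)
   (stated on the generating pi-system of measurable rectangles:
   P(A /\ {W_t - W_s in B_1 x ... x B_n}) = P(A) * prod_i N(0,t-s)(B_i)). *)
Definition is_Wiener {R : realType} {dO : measure_display} {Omega : measurableType dO}
  (n : nat) (P : probability Omega R) (F : R -> set (set Omega))
  (W : 'I_n -> R -> Omega -> R) : Prop :=
  [/\ forall i t, 0 <= t -> forall U : set R, measurable U -> F t (W i t @^-1` U),
      forall i omega, W i 0 omega = 0,
      forall i omega, {within `[0, +oo[%classic, continuous (fun t => W i t omega)}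
    & forall s t, 0 <= s -> s < t -> forall A, F s A ->
        forall B : 'I_n -> set R, (forall i, measurable (B i)) ->
        P (A `&` [set omega | forall i, B i (W i t omega - W i s omega)]) =
        (P A * \big[*%E/1%E]_(i < n) normal_prob 0 (Num.sqrt (t - s)) (B i))%E].

Definition prog_measurable {R : realType} {dO : measure_display} {Omega : measurableType dO}
  (n : nat) (F : R -> set (set Omega)) (beta : 'I_n -> R -> Omega -> R) : Prop :=
  forall t, 0 <= t -> forall i (U : set R), measurable U ->
    <<s (`[0, t]%classic `*` setT),
        [set X | exists (B : set R) (A : set Omega),
           [/\ measurable B, B `<=` `[0, t]%classic, F t A & X = B `*` A]] >>
      ((`[0, t]%classic `*` setT) `&` [set p | U (beta i p.1 p.2)]).

(* Paths: functions 'I_n -> R -> R (component, time); only times t >= 0 matter.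
   Measurable sets of path space: the cylinder sigma-algebra generated by the
   evaluations x |-> x i t, t >= 0 (its trace on C([0,oo),R^n) is the Borel
   sigma-algebra of C([0,oo),R^n)). *)
Definition path_measurable {R : realType} (n : nat) : set (set ('I_n -> R -> R)) :=
  <<s [set C | exists (i : 'I_n) (t : R) (U : set R),
          [/\ 0 <= t, measurable U & C = [set x | U (x i t)]]] >>.

Definition dTV {R : realType} {dO : measure_display} {Omega : measurableType dO}
  (n : nat) (P : probability Omega R) (X Y : Omega -> ('I_n -> R -> R)) : \bar R :=
  ereal_sup [set (`|P (X @^-1` A) - P (Y @^-1` A)|)%E | A in @path_measurable R n].

Definition path_of {R : realType} {dO : measure_display} {Omega : measurableType dO}
  (n : nat) (W : 'I_n -> R -> Omega -> R) : Omega -> ('I_n -> R -> R) :=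
  fun omega i t => W i t omega.

Definition xi_of {R : realType} {dO : measure_display} {Omega : measurableType dO}
  (n : nat) (beta W : 'I_n -> R -> Omega -> R) : Omega -> ('I_n -> R -> R) :=
  fun omega i t =>
    fine (\int[lebesgue_measure]_(s in `[0%R, t]%classic) (beta i s omega)%:E)%E + W i t omega.

Definition Mdelta {R : realType} {dO : measure_display} {Omega : measurableType dO}
  (n : nat) (P : probability Omega R) (beta : 'I_n -> R -> Omega -> R) (delta : R) : \bar R :=
  (\int[P]_omega poweR
     (\int[lebesgue_measure]_(t in `[0%R, +oo[%classic)
          (\sum_(i < n) beta i t omega ^+ 2)%:E) delta)%E.

(* Main.v *)
(** No stochastic integral is needed.  Fix [K > 0] and delay the drift by [h]: on a
    grid of mesh at most [h], the delayed drift over the step from [s k] to [s k.+1] is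
    [F (s k)]-measurable, so a discrete Gaussian shift gives an explicit density
    turning the law of the delayed process into that of [W] on the grid.  Stopping
    the drift when its energy exceeds [K], Jensen's inequality yields
    [a P(y in A) <= E min(K, energy) / 2 + ln (1 + P(W in A) (e^a - 1))].
    By Cauchy-Schwarz the cost of the delayed drift is at most the truncated energy,
    and on [{energy <= K}] the delayed process converges to [xi] as [h] tends to [0].
    Hence the inequality passes to open cylinders, and by outer regularity of the
    law of [W] alone to all measurable sets of paths, up to the probability of
    [{energy > K}].  The three bounds are choices of [a] and [K]: [a = ln N],
    [K = 2 ln N] for the lower bound (which implies the bound near 1), and, via
    Hoeffding's lemma (that is, Pinsker's inequality), [K = (4 M)^(1/(1+delta))]. *)
Require Import Defs.
From HB Require Import structures.
From mathcomp Require Import all_boot all_order all_algebra.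
From mathcomp Require Import all_classical all_reals all_analysis.
From mathcomp Require Import measurable_realfun normal_distribution ring lra.
Set Implicit Arguments. Unset Strict Implicit. Unset Printing Implicit Defensive.
Import Order.TTheory GRing.Theory Num.Theory.
Import numFieldNormedType.Exports.
Local Open Scope classical_set_scope.
Local Open Scope ring_scope.

(** * Gaussian shifts *)

Section gaussian_shift.
Context {R : realType}.
Implicit Types (s v : R) (B : set R).
Local Notation mu := (@lebesgue_measure R).

(** The drift of [xi] over a grid step is unknown at the start of the step, so no discrete density
    applies to [xi] itself; and the event that the total energy is at most [K] need not be known at
    any finite time. The delay cures the first defect. Switching the drift off according to the
    energy spent so far cures the second, and changes nothing on that event. The density carries the
    law of the delayed process to that of [W], while the mean is taken under [P]: Jensen thus
    produces minus the mean log-density, which is half the mean cost because its Gaussian part has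
    mean zero. The delayed process approaches [xi] at finitely many times only, and the admissible
    error depends on the path; for open sets this still allows a limit through increasing unions. As
    the inequality bounds a probability for [xi] by an increasing function of one for [W], enlarging
    the set costs something on the [W] side only. The moment enters twice: [M / K^delta] bounds the
    probability of a large energy, [K^(1-delta) M] the mean truncated energy. [K] is chosen to make
    the two resulting errors equal. *)

Lemma measurable_shiftr v :
  measurable_fun setT (fun x : measurableTypeR R => (x + v : measurableTypeR R)).
Proof. exact: measurable_funD. Qed.

Lemma lebesgue_measure_shift v B : measurable B ->
  pushforward mu (fun x : measurableTypeR R => (x + v : measurableTypeR R)) B = mu B.
Proof.
move=> mB; apply/esym/lebesgue_measure_unique => //.
- exact: measurable_shiftr.
- move=> m X [[a b] _ <-].
  rewrite [RHS](_ : _ = mu `]a - v, b - v]%classic).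
    rewrite !lebesgue_measure_itv/= !lte_fin ltrD2r; case: ifP => // _.
    by rewrite -!EFinB; congr EFin; ring.
  congr mu; apply/seteqP.
  by split => x/=; rewrite !in_itv/= ltrBlDr lerBrDr.
Qed.

(** The Radon-Nikodym derivative and [normal_pdf] have the same integral over every measurable set,
    hence agree almost everywhere. *)
Lemma ge0_integral_normal_prob s (f : R -> \bar R) : s != 0 ->
  measurable_fun setT f -> (forall x, 0 <= f x)%E ->
  (\int[normal_prob 0 s]_x f x = \int[mu]_x (f x * (normal_pdf 0 s x)%:E))%E.
Proof.
move=> s0 mf f0; have dom := normal_prob_dominates 0 s.
rewrite -(Radon_Nikodym_SigmaFinite.change_of_variables dom)//=.
have ifn := Radon_Nikodym_SigmaFinite.f_integrable dom.
apply: ae_eq_integral => //.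
- by apply: emeasurable_funM => //; exact: measurable_int ifn.
- by apply: emeasurable_funM => //; apply/measurable_EFinP; exact: measurable_normal_pdf.
- apply: ae_eqe_mul2l; apply: integral_ae_eq => //.
  + by apply/measurable_EFinP; exact: measurable_normal_pdf.
  + by move=> E _ mE; rewrite -Radon_Nikodym_SigmaFinite.f_integral.
Qed.

(** One-dimensional Cameron-Martin formula. Completing the square, the weight times the centred
    density at [y] is the density at [y + v], and Lebesgue measure is translation invariant. The
    value does not depend on [v], so [v] may later be a random drift known before the increment. *)
Lemma normal_prob_shift s v B : s != 0 -> measurable B ->
  (\int[normal_prob 0 s]_y
     (\1_B (y + v) * expR (- (v * y) / s ^+ 2 - v ^+ 2 / (s ^+ 2 *+ 2)))%:E
   = normal_prob 0 s B)%E.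
Proof.
move=> s0 mB.
have s20 : s ^+ 2 != 0 by rewrite expf_neq0.
rewrite ge0_integral_normal_prob//; last first.
  apply/measurable_EFinP; apply: measurable_funM.
    rewrite -[X in measurable_fun _ X]/(\1_B \o (fun y : R => y + v)).
    apply: measurableT_comp; first exact: measurable_indic.
    exact: measurable_shiftr.
  apply: measurableT_comp => //; apply: measurable_funB => //.
  by apply: measurable_funM => //; apply: measurableT_comp => //; exact: measurable_funM.
transitivity (\int[mu]_y ((fun y => (\1_B y * normal_pdf 0 s y)%:E) \o
    (fun x : measurableTypeR R => (x + v : measurableTypeR R)%R)) y)%E.
  apply: eq_integral => y _ /=; rewrite -EFinM -mulrA; congr (_ * _)%:E.
  rewrite normal_pdfE//= /normal_fun mulrCA -expRD; congr (_ * expR _).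
  by rewrite !subr0; field.
have mf : measurable_fun setT (fun y => (\1_B y * normal_pdf 0 s y)%:E).
  apply/measurable_EFinP; apply: measurable_funM; last exact: measurable_normal_pdf.
  exact: measurable_indic.
rewrite -(preimage_setT (fun x : measurableTypeR R => (x + v : measurableTypeR R))).
rewrite -(ge0_integral_pushforward (measurable_shiftr v))//; first last.
  by move=> y _; rewrite lee_fin mulr_ge0// normal_pdf_ge0.
rewrite (eq_measure_integral mu); last first.
  by move=> m A mA _; exact: lebesgue_measure_shift.
  exact: measurable_shiftr.
rewrite /normal_prob [RHS]integral_mkcond; apply: eq_integral => x _.
rewrite /patch indicE; case: ifP => _; by rewrite ?mul1r ?mul0r.
Qed.

Lemma normal_prob_sym s (f : R -> \bar R) : s != 0 -> measurable_fun setT f ->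
  (forall x, 0 <= f x)%E ->
  (\int[normal_prob 0 s]_y f (- y)%R = \int[normal_prob 0 s]_y f y)%E.
Proof.
move=> s0 mf f0.
have mfN : measurable_fun setT (fun y : R => f (- y)%R) by apply: measurableT_comp.
rewrite !ge0_integral_normal_prob//.
pose g y := (f y * (normal_pdf 0 s y)%:E)%E.
have mg : measurable_fun setT g.
  by apply: emeasurable_funM => //; apply/measurable_EFinP; exact: measurable_normal_pdf.
transitivity (\int[mu]_y (g \o (-%R : _ -> measurableTypeR R)) y)%E.
  apply: eq_integral => y _; rewrite /g/=; congr (_ * (_)%:E)%E.
  by rewrite !normal_pdfE//= /normal_fun !subr0 sqrrN.
rewrite -(preimage_setT (-%R : _ -> measurableTypeR R)).
rewrite -ge0_integral_pushforward//; last first.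
  by move=> y _; rewrite mule_ge0// lee_fin normal_pdf_ge0.
by apply: eq_measure_integral => A mA _; exact: lebesgue_measureN.
Qed.

(* The shift identity with [B = setT] gives exponential moments, and these
   dominate the first absolute moment. *)
Lemma normal_prob_abs_lty s : s != 0 ->
  (\int[normal_prob 0 s]_y (`|y|)%:E < +oo)%E.
Proof.
move=> s0.
have s20 : s ^+ 2 != 0 by rewrite expf_neq0.
have mexp v : measurable_fun setT (fun y : R => (expR (v * y))%:E).
  by apply/measurable_EFinP; apply: measurableT_comp => //; exact: measurable_funM.
have expfin (v : R) : (\int[normal_prob 0 s]_y (expR (v * y))%:E < +oo)%E.
  have := normal_prob_shift (- (v * s ^+ 2)) s0 measurableT.
  rewrite (_ : normal_prob 0 s setT = 1%E); last exact: (@probability_setT _ _ _ (normal_prob 0 s)).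
  set c := expR (- (- (v * s ^+ 2)) ^+ 2 / (s ^+ 2 *+ 2)).
  under eq_integral => y _.
    rewrite indicE in_setT mul1r.
    rewrite (_ : expR _ = c * expR (v * y)); last first.
      by rewrite /c -expRD; congr expR; field.
    rewrite EFinM; over.
  rewrite ge0_integralZl//; last 2 first.
  - exact: mexp.
  - by rewrite lee_fin expR_ge0.
  move=> h; rewrite ltey; apply/eqP => oo; move: h.
  by rewrite oo gt0_muley// lte_fin expR_gt0.
apply: (@le_lt_trans _ _ (\int[normal_prob 0 s]_y ((expR (1 * y))%:E + (expR (- 1 * y))%:E))%E).
  apply: ge0_le_integral => //.
  - by apply/measurable_EFinP; exact: normr_measurable.
  - exact: (emeasurable_funD (mexp 1) (mexp (-1))).
  move=> y _; rewrite -EFinD lee_fin mul1r mulN1r.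
  have := expR_ge1Dx y; have := expR_ge1Dx (- y).
  have := expR_ge0 y; have := expR_ge0 (- y).
  by case: (ltrgt0P y) => hy; lra.
rewrite ge0_integralD//; first exact: lte_add_pinfty.
all: by first [exact: mexp|move=> y _; rewrite lee_fin expR_ge0].
Qed.

End gaussian_shift.

(** * Independence and freezing *)

Section law_uniqueness.
Context {R : realType} {d0 d : measure_display} {Omega : measurableType d0}
  {T : measurableType d} (mu : {measure set Omega -> \bar R}).

Lemma measurable_preimageT d1 d2 (T1 : measurableType d1) (T2 : measurableType d2)
  (f : T1 -> T2) (A : set T2) : measurable_fun setT f -> measurable A ->
  measurable (f @^-1` A).
Proof. by move=> mf mA; rewrite -[X in measurable X]setTI; exact: mf. Qed.

Lemma ge0_integral_preimageC (f : Omega -> T) (Z : Omega -> \bar R) (A : set T) :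
  measurable_fun setT f -> measurable_fun setT Z -> (forall x, 0 <= Z x)%E ->
  measurable A ->
  (\int[mu]_x Z x = \int[mu]_(x in f @^-1` A) Z x + \int[mu]_(x in f @^-1` (~` A)) Z x)%E.
Proof.
move=> mf mZ Z0 mA; rewrite -(setvU (f @^-1` A)) setUC ge0_integral_setU//.
- exact: measurable_preimageT.
- by apply: measurableC; exact: measurable_preimageT.
- exact: measurable_funTS.
- by rewrite disj_set2E setICr.
Qed.

(** The two sides are finite measures in [A] of equal mass, so agreement on a pi-system extends by
    Dynkin's theorem. The weights allow an image under a density to be compared with an unweighted
    image. *)
Lemma ge0_density_unique (G : set (set T)) (f1 f2 : Omega -> T) (Z1 Z2 : Omega -> \bar R) :
  @measurable _ T = <<s G >> -> setI_closed G ->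
  measurable_fun setT f1 -> measurable_fun setT f2 ->
  measurable_fun setT Z1 -> measurable_fun setT Z2 ->
  (forall x, 0 <= Z1 x)%E -> (forall x, 0 <= Z2 x)%E ->
  (\int[mu]_x Z1 x < +oo)%E -> (\int[mu]_x Z1 x = \int[mu]_x Z2 x)%E ->
  (forall A, G A -> \int[mu]_(x in f1 @^-1` A) Z1 x = \int[mu]_(x in f2 @^-1` A) Z2 x)%E ->
  forall A, measurable A ->
    (\int[mu]_(x in f1 @^-1` A) Z1 x = \int[mu]_(x in f2 @^-1` A) Z2 x)%E.
Proof.
move=> mG GI mf1 mf2 mZ1 mZ2 Z10 Z20 Zoo ZT ZG A mA.
have {}mA : <<s G >> A by rewrite -mG.
move: A mA; apply: dynkin_induction => //.
- move=> A mA eqA; have := ge0_integral_preimageC mf2 mZ2 Z20 mA.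
  rewrite -ZT (ge0_integral_preimageC mf1 mZ1 Z10 mA) eqA => eqD.
  have fA : (\int[mu]_(x in f2 @^-1` A) Z2 x)%E \is a fin_num.
    rewrite -eqA ge0_fin_numE; last exact: integral_ge0.
    apply: le_lt_trans Zoo; apply: ge0_subset_integral => //.
    exact: measurable_preimageT.
  rewrite -[LHS](addeK _ fA) -[RHS](addeK _ fA); congr (_ - _)%E.
  by rewrite addeC eqD addeC.
- move=> F mF tF eqF; rewrite !preimage_bigcup.
  have tp (f : Omega -> T) : trivIset setT (fun k => f @^-1` F k).
    apply/trivIsetP => i j _ _ ij; rewrite -preimage_setI.
    by move/trivIsetP : tF => -> //; rewrite preimage_set0.
  rewrite !ge0_integral_bigcup//.
  + by apply: eq_eseriesr => i _; exact: eqF.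
  + by move=> k; exact: measurable_preimageT.
  + exact: measurable_funTS.
  + by move=> k; exact: measurable_preimageT.
  + exact: measurable_funTS.
Qed.

End law_uniqueness.

Section freezing.
Context {R : realType} {d0 : measure_display} {Omega : measurableType d0}
  (P : probability Omega R).

(** Independence makes the joint law of [U] and [G] a product, and Tonelli's theorem integrates out
    [G] with [U] frozen. *)
Lemma integral_independent (d : measure_display) (T : measurableType d) (U : Omega -> T)
    (G : Omega -> measurableTypeR R) (gam : probability (measurableTypeR R) R)
    (psi : T * measurableTypeR R -> \bar R) :
  measurable_fun setT U -> measurable_fun setT G ->
  (forall C B, measurable C -> measurable B ->
    P (U @^-1` C `&` G @^-1` B) = (P (U @^-1` C) * gam B)%E) ->
  measurable_fun setT psi -> (forall x, 0 <= psi x)%E ->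
  (\int[P]_w psi (U w, G w) = \int[P]_w \int[gam]_y psi (U w, y))%E.
Proof.
move=> mU mG ind mpsi psi0.
pose U' : {mfun Omega >-> T} := HB.pack U (isMeasurableFun.Build _ _ _ _ _ mU).
have mUG : measurable_fun setT (fun w => (U w, G w)) by exact: measurable_fun_pair.
pose V : {mfun Omega >-> (T * measurableTypeR R)%type} :=
  HB.pack (fun w => (U w, G w)) (isMeasurableFun.Build _ _ _ _ _ mUG).
transitivity (\int[distribution P V]_z psi z)%E.
  by rewrite ge0_integral_distribution.
transitivity (\int[distribution P U' \x gam]_z psi z)%E.
  apply: eq_measure_integral => A mA _; apply/esym.
  apply: product_measure_unique => // C B mC mB.
rewrite fubini_tonelli1// /fubini_F ge0_integral_distribution//.
- exact: measurable_fun_fubini_tonelli_F.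
- by move=> x; exact: integral_ge0.
Qed.


Lemma measurable_forall_preimage n (G : 'I_n -> Omega -> measurableTypeR R)
    (B : 'I_n -> set (measurableTypeR R)) :
  (forall i, measurable_fun setT (G i)) -> (forall i, measurable (B i)) ->
  measurable [set w | forall i, B i (G i w)].
Proof.
move=> mG mB; rewrite (_ : mkset _ = \bigcap_(i in [set: 'I_n]) (G i @^-1` B i)).
  by apply: fin_bigcap_measurable => // i _; exact: measurable_preimageT.
by apply/seteqP; split => [w h i _|w h i]; [exact: h|exact: (h i)].
Qed.

(** Moves the first increment to the side of the conditioning variable, as the induction of the next
    lemma requires. On rectangles the identity follows from two uses of the hypothesis, one of them
    with all other sets equal to [setT]; Dynkin's theorem does the rest. *)
Lemma independent_extend n (d : measure_display) (T : measurableType d)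
    (U : Omega -> T) (G : 'I_n.+1 -> Omega -> measurableTypeR R)
    (gam : 'I_n.+1 -> probability (measurableTypeR R) R) :
  measurable_fun setT U -> (forall i, measurable_fun setT (G i)) ->
  (forall C B, measurable C -> (forall i, measurable (B i)) ->
    P (U @^-1` C `&` [set w | forall i, B i (G i w)]) =
    (P (U @^-1` C) * \prod_(i < n.+1) gam i (B i))%E) ->
  forall C B, measurable C -> (forall i, measurable (B i)) ->
    P ((fun w => (U w, G ord0 w)) @^-1` C `&`
       [set w | forall i, B i (G (lift ord0 i) w)]) =
    (P ((fun w => (U w, G ord0 w)) @^-1` C) *
       \prod_(i < n) gam (lift ord0 i) (B i))%E.
Proof.
move=> mU mG ind C B mC mB.
set U' := fun w => (U w, G ord0 w); set D := [set w | _].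
have mU' : measurable_fun setT U' by exact: measurable_fun_pair.
have mD : measurable D by exact: measurable_forall_preimage.
pose p := \prod_(i < n) fine (gam (lift ord0 i) (B i)).
have pE : (\prod_(i < n) gam (lift ord0 i) (B i))%E = p%:E.
  rewrite /p -prodEFin; apply: eq_bigr => i _.
  by rewrite fineK// fin_num_measure.
have p0 : 0 <= p by apply: prodr_ge0 => i _; exact: fine_ge0.
have lE A : measurable A -> (\int[P]_(x in U' @^-1` A) (\1_D x)%:E = P (U' @^-1` A `&` D))%E.
  by move=> mA; rewrite integral_indic// 1?setIC//; exact: measurable_preimageT.
have rE A : measurable A -> (\int[P]_(x in U' @^-1` A) (cst p%:E) x = P (U' @^-1` A) * p%:E)%E.
  by move=> mA; rewrite integral_cst 1?muleC//; exact: measurable_preimageT.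
have rect A B0 : measurable A -> measurable B0 ->
    P (U' @^-1` (A `*` B0) `&` D) = (P (U' @^-1` (A `*` B0)) * p%:E)%E.
  move=> mA mB0.
  have := ind A (fun i => if unlift ord0 i is Some j then B j else B0) mA.
  rewrite big_ord_recl unlift_none.
  under eq_bigr do rewrite liftK.
  rewrite pE => h1.
  have := ind A (fun i => if unlift ord0 i is Some j then setT else B0) mA.
  rewrite big_ord_recl unlift_none.
  under eq_bigr do rewrite liftK probability_setT.
  rewrite big1// mule1 => h.
  have -> : P (U' @^-1` (A `*` B0)) = (P (U @^-1` A) * gam ord0 B0)%E.
    rewrite -h; last by move=> i; case: unliftP.
    congr (P _); apply/seteqP; split => w /=.
      by move=> [Aw Bw]; split => // i; case: unliftP => [j|] ->.
    by move=> [Aw /(_ ord0)]; rewrite unlift_none.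
  rewrite -muleA -h1; last by move=> i; case: unliftP.
  congr (P _); apply/seteqP; split => w /=.
    by move=> [[Aw Bw] Dw]; split => // i; case: unliftP => [j|] ->//; exact: Dw.
  move=> [Aw h']; split; last by move=> i; have := h' (lift ord0 i); rewrite liftK.
  by split => //; have := h' ord0; rewrite unlift_none.
rewrite pE -lE// -rE//.
apply: (ge0_density_unique (G := [set A `*` B0 | A in measurable & B0 in measurable])) => //.
- exact: measurable_prod_measurableType.
- move=> _ _ [A1 mA1 [B1 mB1 <-]] [A2 mA2 [B2 mB2 <-]]; rewrite -setXI.
  by exists (A1 `&` A2); [exact: measurableI|exists (B1 `&` B2) => //; exact: measurableI].
- by apply/measurable_EFinP; exact: measurable_indic.
- by rewrite integral_indic// setIT; apply: le_lt_trans (probability_le1 _ mD) _; rewrite ltry.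
- have := lE _ measurableT; have := rE _ measurableT; rewrite preimage_setT => -> ->.
  by rewrite -(preimage_setT U') -setXTT rect.
- move=> _ [A mA [B0 mB0 <-]].
  by rewrite lE; [rewrite rE; [exact: rect|]|]; exact: measurableX.
Qed.

Lemma integral_independent_prod n : forall (d : measure_display) (T : measurableType d)
    (U : Omega -> T) (G : 'I_n -> Omega -> measurableTypeR R)
    (gam : 'I_n -> probability (measurableTypeR R) R)
    (X : T -> R) (psi : 'I_n -> T * measurableTypeR R -> R) (c : 'I_n -> R),
  measurable_fun setT U -> (forall i, measurable_fun setT (G i)) ->
  (forall C B, measurable C -> (forall i, measurable (B i)) ->
    P (U @^-1` C `&` [set w | forall i, B i (G i w)]) =
    (P (U @^-1` C) * \prod_(i < n) gam i (B i))%E) ->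
  measurable_fun setT X -> (forall u, 0 <= X u) ->
  (forall i, measurable_fun setT (psi i)) -> (forall i u, 0 <= psi i u) ->
  (forall i u, \int[gam i]_y (psi i (u, y))%:E = (c i)%:E)%E ->
  (\int[P]_w (X (U w) * \prod_(i < n) psi i (U w, G i w))%:E =
   (\int[P]_w (X (U w))%:E) * (\prod_(i < n) c i)%:E)%E.
Proof.
elim: n => [|n IH] d T U G gam X psi c mU mG ind mX X0 mpsi psi0 psiE.
  by rewrite big_ord0 mule1; apply: eq_integral => w _; rewrite big_ord0 mulr1.
pose U' w := (U w, G ord0 w).
pose X' (z : T * measurableTypeR R) := X z.1 * psi ord0 z.
have mU' : measurable_fun setT U' by exact: measurable_fun_pair.
have mX' : measurable_fun setT X'.
  by apply: measurable_funM => //; exact: measurableT_comp.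
have X'0 z : 0 <= X' z by exact: mulr_ge0.
have mg : measurable_fun setT
    (fun z : T * measurableTypeR R * measurableTypeR R => (z.1.1, z.2)).
  apply: measurable_fun_pair; last exact: measurable_snd.
  exact: (measurableT_comp measurable_fst measurable_fst).
transitivity (\int[P]_w (X' (U' w) *
    \prod_(i < n) psi (lift ord0 i) ((U' w).1, G (lift ord0 i) w))%:E)%E.
  by apply: eq_integral => w _; rewrite big_ord_recl /X'/= mulrA.
rewrite (IH _ _ U' (fun i => G (lift ord0 i)) (fun i => gam (lift ord0 i)) X'
   (fun i z => psi (lift ord0 i) (z.1.1, z.2)) (fun i => c (lift ord0 i)))//; first last.
- by move=> i u; rewrite -(psiE (lift ord0 i) u.1).
- move=> i; exact: (measurableT_comp (mpsi (lift ord0 i)) mg).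
- exact: independent_extend.
rewrite big_ord_recl EFinM muleA; congr (_ * _)%E.
rewrite (integral_independent (gam := gam ord0) (psi := EFin \o X') mU (mG ord0)).
- under eq_integral => w _.
    rewrite /X'/=; under eq_integral do rewrite EFinM.
    rewrite ge0_integralZl//; last 3 first.
    + apply/measurable_EFinP.
      exact: (measurableT_comp (mpsi ord0) (pair1_measurable (U w))).
    + by move=> y _; rewrite lee_fin.
    + by rewrite lee_fin.
    rewrite psiE muleC; over.
  rewrite ge0_integralZl// 1?muleC//.
  + by apply/measurable_EFinP; exact: measurableT_comp.
  + by move=> w _; rewrite lee_fin.
  + by rewrite -(psiE ord0 point); apply: integral_ge0 => y _; rewrite lee_fin.
- move=> C B mC mB; have := ind C (fun i => if i == ord0 then B else setT) mC.
  rewrite big_ord_recl eqxx big1 ?mule1; last by move=> i _; rewrite lift_eqF probability_setT.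
  move=> <-; last by move=> i; case: ifP.
  congr (P _); apply/seteqP; split => w /= [Cw h]; split => //.
    by move=> i; case: eqP => // ->.
  exact: (h ord0).
- exact/measurable_EFinP.
- by move=> z; rewrite lee_fin.
Qed.

End freezing.

(** * Discrete Girsanov transform *)

Section measurability_tools.
Context {R : realType}.

Lemma measurable_fun_sumr (d : measure_display) (T : measurableType d) (D : set T) (I : Type)
    (r : seq I) (Q : pred I) (f : I -> T -> R) : (forall i, measurable_fun D (f i)) ->
  measurable_fun D (fun x => \sum_(i <- r | Q i) f i x).
Proof.
move=> mf; elim: r => [|i r IH].
  by under eq_fun do rewrite big_nil; exact: measurable_cst.
under eq_fun do rewrite big_cons; case: (Q i) => //.
exact: measurable_funD.
Qed.

Lemma measurable_fun_prodr (d : measure_display) (T : measurableType d) (D : set T) (I : Type)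
    (r : seq I) (Q : pred I) (f : I -> T -> R) : (forall i, measurable_fun D (f i)) ->
  measurable_fun D (fun x => \prod_(i <- r | Q i) f i x).
Proof.
move=> mf; elim: r => [|i r IH].
  by under eq_fun do rewrite big_nil; exact: measurable_cst.
under eq_fun do rewrite big_cons; case: (Q i) => //.
exact: measurable_funM.
Qed.

(* Real functions measurable for a sub-sigma-algebra [F], phrased as measurable
   functions on the type [Omega] re-equipped with [F]. *)
Lemma measurable_fun_g_sigma (T : pointedType) (F : set (set T)) (f : T -> R) :
  sigma_algebra setT F ->
  (measurable_fun setT (f : g_sigma_algebraType F -> R) <->
   forall U : set R, measurable U -> F (f @^-1` U)).
Proof.
move=> sF; have FE : <<s F >> = F by exact: sigma_algebra_id.
split=> [mf U mU|h _ U mU].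
  have := mf measurableT U mU; rewrite setTI /measurable/=.
  by move: (f @^-1` U) => A; rewrite -{2}FE.
by rewrite setTI; apply: sub_sigma_algebra; exact: h.
Qed.

End measurability_tools.

Section discrete_girsanov.
Context {R : realType} {d0 : measure_display} {Omega : measurableType d0}
  (n : nat) (P : probability Omega R) (F : R -> set (set Omega))
  (W : 'I_n -> R -> Omega -> R).
Hypotheses (filF : filtration F) (WW : is_Wiener P F W).
Variable s : nat -> R.
Hypotheses (s0 : s 0%N = 0) (sS : forall k, s k < s k.+1).
Variable b : nat -> 'I_n -> Omega -> R.
Hypothesis mb : forall k i (U : set R), measurable U -> F (s k) (b k i @^-1` U).

Definition grid_incr k i w := W i (s k.+1) w - W i (s k) w.
(** [b k i] is the whole displacement over a step, not a rate. This is the exponent of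
    [normal_prob_shift] for the shift [b k i] and the variance [s k.+1 - s k]. *)
Definition grid_logd k i w : R :=
  - (b k i w * grid_incr k i w) / (s k.+1 - s k)
  - b k i w ^+ 2 / ((s k.+1 - s k) *+ 2).
Definition grid_dens L w := \prod_(k < L) \prod_(i < n) expR (grid_logd k i w).

Local Notation sg k := (Num.sqrt (s k.+1 - s k)).

Lemma grid_ge0 k : 0 <= s k.
Proof. by elim: k => [|k IH]; [rewrite s0|exact: le_trans IH (ltW (sS k))]. Qed.

Lemma grid_le j k : (j <= k)%N -> s j <= s k.
Proof.
by move=> /subnK <-; elim: (k - j)%N => // m IH; rewrite addSn (le_trans IH)// ltW.
Qed.

Lemma grid_sg_neq0 k : sg k != 0.
Proof. by rewrite gt_eqF// sqrtr_gt0 subr_gt0. Qed.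

Lemma grid_sgX k : sg k ^+ 2 = s k.+1 - s k.
Proof. by rewrite sqr_sqrtr// subr_ge0 ltW. Qed.

Lemma measurable_grid (k L : nat) i : (k < L)%N ->
  measurable_fun setT (grid_incr k i : g_sigma_algebraType (F (s L)) -> R) /\
  measurable_fun setT (b k i : g_sigma_algebraType (F (s L)) -> R).
Proof.
move=> kL; have [sF mF nF] := filF; have [adW _ _ _] := WW.
have sFL : sigma_algebra setT (F (s L)) by apply: sF; exact: grid_ge0.
have mW j : (j <= L)%N ->
    measurable_fun setT (W i (s j) : g_sigma_algebraType (F (s L)) -> R).
  move=> jL; apply/measurable_fun_g_sigma => // U mU.
  apply: (nF (s j)); [exact: grid_ge0|exact: grid_le|].
  by apply: adW => //; exact: grid_ge0.
split; first by apply: measurable_funB; apply: mW => //; exact: ltnW.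
apply/measurable_fun_g_sigma => // U mU.
by apply: (nF (s k)); [exact: grid_ge0|apply/grid_le/ltnW|exact: mb].
Qed.

Lemma measurable_gridF (L : nat) i :
  measurable_fun setT (b L i : g_sigma_algebraType (F (s L)) -> R).
Proof.
have [sF _ _] := filF.
by apply/measurable_fun_g_sigma; [apply: sF; exact: grid_ge0|move=> U mU; exact: mb].
Qed.

Lemma measurable_id_filtration L :
  measurable_fun setT (id : Omega -> g_sigma_algebraType (F (s L))).
Proof.
have [sF mF _] := filF => _ A; rewrite setTI preimage_id /measurable/=.
by rewrite (sigma_algebra_id (sF _ (grid_ge0 L))); apply: mF; exact: grid_ge0.
Qed.

Lemma measurable_of_filtration L (f : Omega -> R) :
  measurable_fun setT (f : g_sigma_algebraType (F (s L)) -> R) ->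
  measurable_fun setT f.
Proof.
have [sF mF _] := filF; have sFL := sF _ (grid_ge0 L).
move=> /(measurable_fun_g_sigma f sFL) mf _ U mU; rewrite setTI.
by apply: (mF (s L)); [exact: grid_ge0|exact: mf].
Qed.

Lemma measurable_grid_incr k i : measurable_fun setT (grid_incr k i).
Proof.
exact: measurable_of_filtration (measurable_grid i (ltnSn k)).1.
Qed.

Lemma measurable_drift k i : measurable_fun setT (b k i).
Proof.
exact: measurable_of_filtration (measurable_grid i (ltnSn k)).2.
Qed.

Lemma measurable_logd (d : measure_display) (T : measurableType d) (f g : T -> R) (v : R) :
  measurable_fun setT f -> measurable_fun setT g ->
  measurable_fun setT (fun w => expR (- (f w * g w) / v - f w ^+ 2 / (v *+ 2))).
Proof.
move=> mf mg; apply: measurableT_comp => //; apply: measurable_funB.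
  apply: measurable_funM => //; apply: measurableT_comp => //; exact: measurable_funM.
by apply: measurable_funM => //; exact: measurable_funX.
Qed.

Lemma grid_independent k (C : set Omega) (B : 'I_n -> set R) :
  F (s k) C -> (forall i, measurable (B i)) ->
  P (C `&` [set w | forall i, B i (grid_incr k i w)]) =
  (P C * \prod_(i < n) normal_prob 0 (sg k) (B i))%E.
Proof. by have [_ _ _ ind] := WW; move=> FC mB; apply: ind => //; exact: grid_ge0. Qed.

(** Induction on the number of steps. Given [F (s L)] the drift of the last step is frozen, and by
    [normal_prob_shift] its factor integrates to a Gaussian probability that does not depend on the
    past. So under the density the shifted increments have the law of those of [W]. *)
Lemma integral_grid_rectangle L (B : nat -> 'I_n -> set R) :
  (forall k i, measurable (B k i)) ->
  (\int[P]_w (\prod_(k < L) \prod_(i < n)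
     (\1_(B k i) (grid_incr k i w + b k i w) * expR (grid_logd k i w)))%:E =
   (\prod_(k < L) \prod_(i < n) fine (normal_prob 0 (sg k) (B k i)))%:E)%E.
Proof.
move=> mB; elim: L => [|L IH].
  under eq_integral do rewrite big_ord0.
  by rewrite big_ord0 integral_cst// mul1e; exact: probability_setT.
rewrite big_ord_recr/= EFinM -IH.
under eq_integral do rewrite big_ord_recr/=.
have [sF mF nF] := filF.
have sFL : sigma_algebra setT (F (s L)) by apply: sF; exact: grid_ge0.
pose T := g_sigma_algebraType (F (s L)).
pose X (w : T) := \prod_(k < L) \prod_(i < n)
     (\1_(B k i) (grid_incr k i w + b k i w) * expR (grid_logd k i w)).
pose psi (i : 'I_n) (z : T * measurableTypeR R) : R :=
  \1_(B L i) (z.2 + b L i z.1) *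
  expR (- (b L i z.1 * z.2) / (s L.+1 - s L) - b L i z.1 ^+ 2 / ((s L.+1 - s L) *+ 2)).
have mind (d : measure_display) (T' : measurableType d) (f g : T' -> R) (B' : set R) :
   measurable B' -> measurable_fun setT f -> measurable_fun setT g ->
   measurable_fun setT (fun x => \1_B' (f x + g x) : R).
  move=> mB' mf mg.
  rewrite -[X in measurable_fun _ X]/(\1_B' \o (fun x => f x + g x)).
  by apply: measurableT_comp; [exact: measurable_indic|exact: measurable_funD].
(* The identity into [Omega] equipped with [F (s L)] is the conditioning variable: every
   [F (s L)]-measurable quantity is a function of it. *)
apply: (integral_independent_prod (U := id : Omega -> T) (G := fun i => grid_incr L i : Omega -> measurableTypeR R)
  (gam := fun i => normal_prob 0 (sg L)) (X := X) (psi := psi)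
  (c := fun i => fine (normal_prob 0 (sg L) (B L i)))).
- exact: measurable_id_filtration.
- by move=> i; exact: measurable_grid_incr.
- move=> C B' mC mB'; apply: grid_independent => //.
  by have := mC; rewrite /measurable/= sigma_algebra_id.
- apply: measurable_fun_prodr => k; apply: measurable_fun_prodr => i.
  have [mG mbk] := measurable_grid i (ltn_ord k).
  by apply: measurable_funM; [exact: mind|exact: measurable_logd].
- by move=> u; do 2! apply: prodr_ge0 => ? _; rewrite mulr_ge0// expR_ge0.
- move=> i.
  have mb1 : measurable_fun setT (fun z : T * measurableTypeR R => b L i z.1).
    rewrite -[X in measurable_fun _ X]/((b L i : T -> R) \o fst).
    by apply: measurableT_comp; [exact: measurable_gridF|exact: measurable_fst].
  have mb2 : measurable_fun setT (fun z : T * measurableTypeR R => z.2 : R).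
    exact: measurable_snd.
  by apply: measurable_funM; [exact: mind|exact: measurable_logd].
- by move=> i u; rewrite mulr_ge0// expR_ge0.
- move=> i u; rewrite /psi/=.
  rewrite fineK; last by apply: fin_num_measure; exact: mB.
  by rewrite -(normal_prob_shift (b L i u) (grid_sg_neq0 L) (mB L i)) grid_sgX.
Qed.

End discrete_girsanov.

(** * Entropy inequality *)

Section entropy_inequality.
Context {R : realType} {d0 : measure_display} {Omega : measurableType d0}
  (P : probability Omega R).

(* Tangent-line inequality [e^x >= 1 + x] at [x = a 1_E + l - ln J], where [J] is
   the right-hand exponential moment, then integrate. *)
Lemma entropy_inequality (E : set Omega) (l : Omega -> R) (a : R) :
  measurable E -> measurable_fun setT l -> P.-integrable setT (EFin \o l) -> 0 <= a ->
  (\int[P]_w (expR (l w))%:E = 1)%E ->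
  a * fine (P E) + \int[P]_w (l w) <=
  ln (1 + fine (\int[P]_(w in E) (expR (l w))%:E)%E * (expR a - 1)).
Proof.
move=> mE ml il a0 l1.
set q := fine (\int[P]_(w in E) (expR (l w))%:E)%E; set J := 1 + q * (expR a - 1).
have me : measurable_fun setT (fun w => expR (l w)) by exact: measurableT_comp.
have ie : P.-integrable setT (EFin \o (fun w => expR (l w))).
  apply/integrableP; split; first exact/measurable_EFinP.
  under eq_integral do rewrite /= ger0_norm ?expR_ge0//.
  by rewrite l1 ltry.
have q0 : 0 <= q by apply: fine_ge0; apply: integral_ge0 => w _; rewrite lee_fin expR_ge0.
have J0 : 0 < J by rewrite ltr_pwDl// mulr_ge0// subr_ge0 -expR0 ler_expR.
have i1E : P.-integrable setT (EFin \o (\1_E : Omega -> R)).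
  exact: integrable_indic.
have mee : measurable_fun setT (fun w => \1_E w * expR (l w)).
  by apply: measurable_funM => //; exact: measurable_indic.
have iee : P.-integrable setT (EFin \o (fun w => \1_E w * expR (l w))).
  apply: le_integrable ie => //; first exact/measurable_EFinP.
  move=> w _; rewrite /= lee_fin normrM ler_piMl// indicE.
  by case: (_ \in _); rewrite ?normr1 ?normr0.
have qE : \int[P]_w (\1_E w * expR (l w)) = q.
  rewrite /q /Rintegral [in RHS]integral_mkcond; congr fine; apply: eq_integral => w _.
  by rewrite patchE indicE; case: ifP => _; rewrite ?mul1r ?mul0r.
pose f w := expR (l w) + (expR a - 1) * (\1_E w * expR (l w)).
pose g w := J * ((1 - ln J) + (a * \1_E w + l w)).
have if_ : P.-integrable setT (EFin \o f).
  have -> : EFin \o f = (EFin \o (fun w => expR (l w))) \+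
      (fun w => (expR a - 1)%R%:E * (EFin \o (fun w => \1_E w * expR (l w))%R) w)%E.
    by apply/funext => w; rewrite /f /= EFinD EFinM.
  by apply: integrableD => //; exact: integrableZl.
have fE : \int[P]_w f w = J.
  rewrite RintegralD//; last exact: (integrableZl _ _ iee).
  rewrite RintegralZl// qE mulrC; congr (_ + _).
  by rewrite /Rintegral l1.
have ial : P.-integrable setT (EFin \o (fun w => a * \1_E w + l w)).
  have -> : EFin \o (fun w => a * \1_E w + l w) =
      (fun w => a%:E * (EFin \o (\1_E : Omega -> R)) w)%E \+ (EFin \o l).
    by apply/funext => w.
  by apply: integrableD => //; exact: integrableZl.
have ic (r : R) : P.-integrable setT (EFin \o (fun _ : Omega => r)).
  exact: finite_measure_integrable_cst.
have icl : P.-integrable setT (EFin \o (fun w => (1 - ln J) + (a * \1_E w + l w))).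
  exact: (integrableD _ (ic (1 - ln J)) ial).
have ig : P.-integrable setT (EFin \o g) by exact: (integrableZl _ _ icl).
have P1 : fine (P setT) = 1 by rewrite probability_setT.
have gE : \int[P]_w g w = J * (1 - ln J + (a * fine (P E) + \int[P]_w (l w))).
  rewrite RintegralZl//; congr (_ * _).
  rewrite RintegralD// Rintegral_cst// P1 mulr1; congr (_ + _).
  rewrite RintegralD//; last exact: (integrableZl _ _ i1E).
  rewrite RintegralZl//; congr (_ * _ + _).
  by rewrite /Rintegral integral_indic// setIT.
have : \int[P]_w g w <= \int[P]_w f w.
  apply: le_Rintegral => // w _; rewrite /f /g.
  have -> : expR (l w) + (expR a - 1) * (\1_E w * expR (l w)) = expR (a * \1_E w + l w).
    rewrite expRD indicE; by case: (_ \in _) => /=; rewrite ?mulr1n ?mulr0n ?mulr1 ?mulr0 ?expR0; ring.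
  have := expR_ge1Dx (a * \1_E w + l w - ln J).
  rewrite expRD expRN lnK ?posrE// => h.
  rewrite -(ler_pM2l J0) in h; apply: le_trans (le_trans h _).
    by rewrite ler_pM2l//; lra.
  by rewrite mulrCA divff ?gt_eqF// mulr1.
rewrite fE gE -[leRHS]mulr1 ler_pM2l//; lra.
Qed.

(* By symmetry of the centred Gaussian, the positive and negative parts of
   [b * G] have the same integral. *)
Lemma independent_mean0 (b : Omega -> R) (G : Omega -> R) (s C : R) : s != 0 ->
  measurable_fun setT b -> measurable_fun setT G -> (forall w, `|b w| <= C) ->
  (forall (A B : set R), measurable A -> measurable B ->
    P (b @^-1` A `&` G @^-1` B) = (P (b @^-1` A) * normal_prob 0 s B)%E) ->
  P.-integrable setT (EFin \o (fun w => b w * G w)) /\ \int[P]_w (b w * G w) = 0.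
Proof.
move=> s0 mb mG bC ind.
have mbG : measurable_fun setT (EFin \o (fun w => b w * G w)).
  by apply/measurable_EFinP; exact: measurable_funM.
have indint := @integral_independent R _ _ P _ R b (G : Omega -> measurableTypeR R) (normal_prob 0 s) _ mb mG ind.
have mfst : measurable_fun setT (fun z : R * measurableTypeR R => z.1) by exact: measurable_fst.
have msnd : measurable_fun setT (fun z : R * measurableTypeR R => z.2 : R) by exact: measurable_snd.
have mmul : measurable_fun setT (fun z : R * measurableTypeR R => z.1 * z.2 : R).
  exact: measurable_funM.
split.
  apply/integrableP; split=> //.
  apply: (@le_lt_trans _ _ (\int[P]_w (C%:E * (`|G w|)%:E))%E).
    apply: ge0_le_integral => //.
    - by apply: measurableT_comp.
    - by apply: measurable_funeM; apply/measurable_EFinP; exact: measurableT_comp.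
    - by move=> w _; rewrite /= lee_fin normrM ler_wpM2r.
  have C0 : 0 <= C by apply: le_trans (bC point).
  rewrite ge0_integralZl//; last first.
    by apply/measurable_EFinP; exact: measurableT_comp.
  rewrite (indint (fun z => (`|z.2 : R|)%:E))//; last first.
    by apply/measurable_EFinP; exact: measurableT_comp.
  set I := (\int[normal_prob 0 s]_y (`|y|)%:E)%E.
  rewrite [X in (_ * X)%E](_ : _ = I); last first.
    transitivity (\int[P]_w (cst I) w)%E => //.
    by rewrite integral_cst// -[RHS]mule1; congr (_ * _)%E; exact: probability_setT.
  by rewrite lte_mul_pinfty// ?normal_prob_abs_lty// ge0_fin_numE// ?normal_prob_abs_lty// integral_ge0.
rewrite /Rintegral integralE.
pose psi (z : R * measurableTypeR R) := (Num.max (z.1 * z.2) 0)%:E.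
have mpsi : measurable_fun setT psi by apply/measurable_EFinP; exact: measurable_maxr.
have psi0 z : (0 <= psi z)%E by rewrite lee_fin le_max lexx orbT.
pose psi' (z : R * measurableTypeR R) := psi (z.1, - z.2).
have mpsi' : measurable_fun setT psi'.
  have mneg : measurable_fun setT (fun z : R * measurableTypeR R => - (z.2 : R)).
    exact: measurableT_comp.
  by apply/measurable_EFinP; apply: measurable_maxr => //; exact: measurable_funM.
have -> : (\int[P]_x ((fun w => (b w * G w)%:E)^\+ x) = \int[P]_w psi (b w, G w))%E.
  by apply: eq_integral => w _; rewrite funeposE /psi/= EFin_max.
have -> : (\int[P]_x ((fun w => (b w * G w)%:E)^\- x) = \int[P]_w psi' (b w, G w))%E.
  by apply: eq_integral => w _; rewrite funenegE /psi'/psi/= EFin_max mulrN.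
rewrite indint// indint//; last by move=> z; exact: psi0.
suff -> : (\int[P]_w \int[normal_prob 0 s]_y psi' (b w, y) =
    \int[P]_w \int[normal_prob 0 s]_y psi (b w, y))%E.
  set I := (X in (X - X)%E); case: I => // r; by rewrite subee.
apply: eq_integral => w _.
rewrite -(normal_prob_sym s0 (f := fun y => psi (b w, y)))//.
have mw : measurable_fun setT (fun y : measurableTypeR R => b w * (y : R)).
  exact: measurable_funM.
by apply/measurable_EFinP; exact: measurable_maxr.
Qed.

End entropy_inequality.

(** * Girsanov transform on path space *)

Section path_girsanov.
Context {R : realType} {d0 : measure_display} {Omega : measurableType d0}
  (n : nat) (P : probability Omega R) (F : R -> set (set Omega))
  (W : 'I_n -> R -> Omega -> R).
Hypotheses (filF : filtration F) (WW : is_Wiener P F W).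
Variable s : nat -> R.
Hypotheses (s0 : s 0%N = 0) (sS : forall k, s k < s k.+1).

Local Notation sg k := (Num.sqrt (s k.+1 - s k)).
Local Notation grid_incr := (grid_incr W s).

(** Increments rather than positions, since the Wiener property and the density factorise over
    them. *)
Definition incr_rectangle L (B : nat -> 'I_n -> set R) : set ('I_n -> R -> R) :=
  [set x | forall k, (k < L)%N -> forall i, B k i (x i (s k.+1) - x i (s k))].

Definition incr_rectangles L : set (set ('I_n -> R -> R)) :=
  [set C | exists2 B, (forall k i, measurable (B k i)) & C = incr_rectangle L B].

Lemma integral_dens_rectangle L (b : nat -> 'I_n -> Omega -> R) (B : nat -> 'I_n -> set R) :
  (forall k i (U : set R), measurable U -> F (s k) (b k i @^-1` U)) ->
  (forall k i, measurable (B k i)) ->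
  (\int[P]_(w in [set w | forall k, (k < L)%N -> forall i,
                     B k i (grid_incr k i w + b k i w)%R]) (grid_dens W s b L w)%:E =
   (\prod_(k < L) \prod_(i < n) fine (normal_prob 0 (sg k) (B k i)))%:E)%E.
Proof.
move=> mb mB; rewrite -(integral_grid_rectangle filF WW s0 sS mb)// integral_mkcond.
apply: eq_integral => w _; rewrite patchE.
under [in RHS]eq_bigr do rewrite big_split/=.
rewrite [in RHS]big_split/= -/(grid_dens W s b L w).
case: ifPn => [|/negP]; rewrite inE/= => h.
  rewrite [X in X * _]big1 ?mul1r// => k _; rewrite big1// => i _.
  by rewrite indicE mem_set//; exact: h.
suff -> : \prod_(k < L) \prod_(i < n) (\1_(B k i) (grid_incr k i w + b k i w) : R) = 0.
  by rewrite mul0r.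
have [k [i nB]] : exists (k : 'I_L) i, ~ B k i (grid_incr k i w + b k i w).
  apply: contra_notP h => h k kL i; apply: contra_notP h => nB.
  by exists (Ordinal kL), i.
rewrite (bigD1 k)//= (bigD1 i)//= indicE memNset//.
by rewrite !mul0r.
Qed.

Lemma measurable_incr L k i : (k < L)%N ->
  measurable_fun setT (fun x : g_sigma_algebraType (incr_rectangles L) =>
    (x : 'I_n -> R -> R) i (s k.+1) - (x : 'I_n -> R -> R) i (s k)).
Proof.
move=> kL _ U mU; rewrite setTI; apply: sub_sigma_algebra.
exists (fun k' i' => if (k' == k) && (i' == i) then U else setT).
  by move=> k' i'; case: ifP.
apply/seteqP; split => x /=.
  by move=> Ux k' k'L i'; case: ifP => // /andP[/eqP -> /eqP ->].
by move=> /(_ k kL i); rewrite !eqxx.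
Qed.

Lemma setI_incr_rectangles L : setI_closed (incr_rectangles L).
Proof.
move=> _ _ [B1 mB1 ->] [B2 mB2 ->]; exists (fun k i => B1 k i `&` B2 k i).
  by move=> k i; exact: measurableI.
apply/seteqP; split => x /=.
  by move=> [h1 h2] k kL i; split; [exact: h1|exact: h2].
by move=> h; split => k kL i; have [] := h k kL i.
Qed.

Lemma measurable_g_sigma (d : measure_display) (T : measurableType d) (U : pointedType)
   (G : set (set U)) (f : T -> U) : (forall A, G A -> measurable (f @^-1` A)) ->
  measurable_fun setT (f : T -> g_sigma_algebraType G).
Proof.
move=> h; apply: (@measurability _ _ T (g_sigma_algebraType G) setT f G) => // _ [A GA <-]; rewrite setTI; exact: h.
Qed.

Variable b : nat -> 'I_n -> Omega -> R.
Hypothesis mb : forall k i (U : set R), measurable U -> F (s k) (b k i @^-1` U).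
Variables (L : nat) (y : Omega -> 'I_n -> R -> R).
Hypothesis y0 : forall w i, y w i 0 = 0.
Hypothesis yS : forall k, (k < L)%N -> forall w i,
  y w i (s k.+1) - y w i (s k) = grid_incr k i w + b k i w.

Lemma measurable_path (z : Omega -> 'I_n -> R -> R) :
  (forall k i, (k < L)%N -> measurable_fun setT (fun w => z w i (s k.+1) - z w i (s k))) ->
  measurable_fun setT (z : Omega -> g_sigma_algebraType (incr_rectangles L)).
Proof.
move=> mz; apply: measurable_g_sigma => _ [B mB ->].
rewrite (_ : _ @^-1` _ = \bigcap_(k in `I_L) \bigcap_(i in [set: 'I_n])
   ((fun w => z w i (s k.+1) - z w i (s k)) @^-1` B k i)); last first.
  apply/seteqP; split => w /=.
    by move=> h k kL i _; exact: h.
  by move=> h k kL i; exact: (h k kL i).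
apply: fin_bigcap_measurable => // k kL; apply: fin_bigcap_measurable => // i _.
by apply: measurable_preimageT => //; exact: mz.
Qed.

Lemma measurable_path_y : measurable_fun setT (y : Omega -> g_sigma_algebraType (incr_rectangles L)).
Proof.
apply: measurable_path => k i kL; under eq_fun do rewrite yS//.
by apply: measurable_funD; [exact: (measurable_grid_incr filF WW s0 sS mb)|exact: (measurable_drift filF WW s0 sS mb)].
Qed.

Lemma measurable_path_W :
  measurable_fun setT (path_of W : Omega -> g_sigma_algebraType (incr_rectangles L)).
Proof. by apply: measurable_path => k i kL; exact: (measurable_grid_incr filF WW s0 sS mb). Qed.

Lemma measurable_grid_dens : measurable_fun setT (grid_dens W s b L).
Proof.
do 2! apply: measurable_fun_prodr => ?; apply: measurable_logd.
  exact: (measurable_drift filF WW s0 sS mb).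
exact: (measurable_grid_incr filF WW s0 sS mb).
Qed.

Lemma grid_dens_ge0 w : 0 <= grid_dens W s b L w.
Proof. by do 2! apply: prodr_ge0 => ? _; exact: expR_ge0. Qed.

Lemma integral_grid_dens : (\int[P]_w (grid_dens W s b L w)%:E = 1)%E.
Proof.
have := @integral_dens_rectangle L b (fun _ _ => setT) mb (fun _ _ => measurableT).
rewrite (_ : mkset _ = setT); last by apply/seteqP; split.
by move=> ->; rewrite !big1// => k _; rewrite big1// => i _; rewrite probability_setT.
Qed.

(** On rectangles both sides are the same product of Gaussian probabilities, the right-hand side
    being the case of zero drift, whose density is 1. *)
Lemma girsanov_incr A : <<s incr_rectangles L >> A ->
  (\int[P]_(w in y @^-1` A) (grid_dens W s b L w)%:E = P (path_of W @^-1` A))%E.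
Proof.
move=> mA.
(* The zero drift is adapted, so the rectangle formula applies to [W] as well. *)
have m0 : forall (k : nat) (i : 'I_n) (U : set R), measurable U -> F (s k) ((fun _ : Omega => 0 : R) @^-1` U).
  move=> k i U mU; have [sF _ _] := filF; have [F0 FC _] := sF _ (grid_ge0 s0 sS k).
  have [U0|U0] := pselect (U 0).
    rewrite (_ : _ @^-1` _ = setT `\` set0); first exact: FC.
    by rewrite setD0; apply/seteqP; split.
  by rewrite (_ : _ @^-1` _ = set0)//; apply/seteqP; split.
transitivity (\int[P]_(w in path_of W @^-1` A) (cst 1%E) w)%E; last first.
  rewrite integral_cst ?mul1e//.
  exact: (measurable_preimageT measurable_path_W).
apply: (@ge0_density_unique R _ _ Omega (g_sigma_algebraType (incr_rectangles L)) P (incr_rectangles L) y (path_of W)) => //.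
- exact: setI_incr_rectangles.
- exact: measurable_path_y.
- exact: measurable_path_W.
- by apply/measurable_EFinP; exact: measurable_grid_dens.
- by move=> w; rewrite lee_fin grid_dens_ge0.
- by rewrite integral_grid_dens ltry.
- rewrite integral_grid_dens integral_cst// mul1e; apply/esym; exact: probability_setT.
- move=> _ [B mB ->].
  transitivity (\prod_(k < L) \prod_(i < n) fine (normal_prob 0 (sg k) (B k i)))%:E.
    rewrite -(integral_dens_rectangle L mb mB); congr (integral _ _ _).
    by apply/seteqP; split => w /= h k kL i; have := h k kL i; rewrite yS.
  rewrite -(integral_dens_rectangle L (b := fun _ _ _ => 0) m0 mB).
  rewrite (_ : mkset _ = path_of W @^-1` incr_rectangle L B).
    apply: eq_integral => w _; rewrite /grid_dens big1// => k _; rewrite big1// => i _.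
    by rewrite /grid_logd expr0n/= !mul0r !oppr0 mul0r addr0 expR0.
  by apply/seteqP; split => w /= h k kL i; have := h k kL i; rewrite addr0.
Qed.

Definition fin_sigma (S : seq R) : set (set ('I_n -> R -> R)) :=
  <<s [set C | exists (i : 'I_n) (t : R) (U : set R),
          [/\ t \in S, measurable U & C = [set x | U (x i t)]]] >>.

Variable S : seq R.
Hypothesis Ss : forall t, t \in S -> exists2 k, (k <= L)%N & t = s k.

(** A position at a grid time is a telescoping sum of increments, up to the starting point. The
    latter is subtracted, which changes nothing for paths started at 0. *)
Lemma fin_sigma_incr A : fin_sigma S A ->
  <<s incr_rectangles L >> [set x : 'I_n -> R -> R | A (fun i t => x i t - x i 0)].
Proof.
pose N (x : 'I_n -> R -> R) i t := x i t - x i 0.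
rewrite -[X in <<s _ >> X]/(N @^-1` A).
have sG := smallest_sigma_algebra setT (incr_rectangles L).
move: A; apply: smallest_sub.
  have [G0 GC GU] := sG; split => /=.
  - by rewrite preimage_set0.
  - move=> A GA; rewrite /mkset.
    suff -> : N @^-1` (setT `\` A) = setT `\` N @^-1` A by exact: GC.
    by apply/seteqP; split.
  - by move=> B GB; rewrite /mkset preimage_bigcup; exact: GU.
move=> _ [i [t [U [tS mU ->]]]] /=.
have [k kL ->] := Ss tS.
have mN : measurable_fun setT (fun x : g_sigma_algebraType (incr_rectangles L) =>
    (x : 'I_n -> R -> R) i (s k) - (x : 'I_n -> R -> R) i (s 0%N)).
  elim: k kL => [|k IH] kL.
    rewrite [X in measurable_fun _ X](_ : _ = cst 0); first exact: measurable_cst.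
    by apply/funext => x; rewrite subrr.
  have := measurable_funD (measurable_incr i kL) (IH (ltnW kL)).
  congr measurable_fun; apply/funext => x /=.
  by rewrite addrA subrK.
have := mN measurableT U mU; rewrite setTI.
by rewrite s0.
Qed.

Lemma girsanov_fin A : fin_sigma S A ->
  [/\ measurable (y @^-1` A), measurable (path_of W @^-1` A) &
  (\int[P]_(w in y @^-1` A) (grid_dens W s b L w)%:E = P (path_of W @^-1` A))%E].
Proof.
move=> /fin_sigma_incr; set A' := [set x | _] => mA'.
have [_ W0 _ _] := WW.
have yE : y @^-1` A = y @^-1` A'.
  rewrite /A' /preimage; apply/seteqP; split => w /=;
    by rewrite (_ : (fun i t => y w i t - y w i 0) = y w)//;
       apply/funext => i; apply/funext => t; rewrite y0 subr0.
have WE : path_of W @^-1` A = path_of W @^-1` A'.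
  rewrite /A' /preimage; apply/seteqP; split => w /=;
    by rewrite (_ : (fun i t => path_of W w i t - path_of W w i 0) = path_of W w)//;
       apply/funext => i; apply/funext => t; rewrite /path_of W0 subr0.
split; rewrite ?yE ?WE.
- exact: (measurable_preimageT measurable_path_y).
- exact: (measurable_preimageT measurable_path_W).
- exact: girsanov_incr.
Qed.

(** This is [entropy_inequality] for the log-density [l = - m - c / 2]. The discrete stochastic
    integral [m] has mean 0, each drift being bounded by [C] and independent of the increment it
    multiplies; hence [l] has mean at least [- D / 2]. *)
Lemma grid_entropy A (a C D : R) : fin_sigma S A -> 0 <= a ->
  (forall k i w, `|b k i w| <= C) ->
  (\int[P]_w (\sum_(k < L) \sum_(i < n) b k i w ^+ 2 / (s k.+1 - s k))%:E <= D%:E)%E ->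
  a * fine (P (y @^-1` A)) <=
  D / 2 + ln (1 + fine (P (path_of W @^-1` A)) * (expR a - 1)).
Proof.
move=> /girsanov_fin[myA mWA AE] a0 bC bD.
pose m w := \sum_(k < L) \sum_(i < n) b k i w * grid_incr k i w / (s k.+1 - s k).
pose c w := \sum_(k < L) \sum_(i < n) b k i w ^+ 2 / (s k.+1 - s k).
pose l w := - m w - 2^-1 * c w.
have sneq k : s k.+1 - s k != 0 by rewrite gt_eqF// subr_gt0.
have lE w : expR (l w) = grid_dens W s b L w.
  rewrite /grid_dens /l /m /c mulr_sumr -!sumrN -big_split/=.
  rewrite (big_morph _ (@expRD R) (@expR0 R)); apply: eq_bigr => k _.
  rewrite mulr_sumr -!sumrN -big_split/=.
  rewrite (big_morph _ (@expRD R) (@expR0 R)); apply: eq_bigr => i _.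
  by rewrite /grid_logd; congr expR; field; rewrite sneq.
have ind k i (A' B' : set R) : measurable A' -> measurable B' ->
    P (b k i @^-1` A' `&` grid_incr k i @^-1` B') =
    (P (b k i @^-1` A') * normal_prob 0 (sg k) B')%E.
  move=> mA' mB'.
  have := grid_independent WW s0 sS (B := fun j => if j == i then B' else setT) (mb k i mA').
  rewrite (bigD1 i)//= eqxx big1 ?mule1; last first.
    by move=> j /negbTE ->; exact: (@probability_setT _ _ _ (normal_prob 0 (sg k))).
  move=> <-; last by move=> j; case: ifP.
  congr (P _); apply/seteqP; split => w /= [Aw h]; split => //.
    by move=> j; case: eqP => // ->.
  by have := h i; rewrite eqxx.
have m0 k i : P.-integrable setT (EFin \o (fun w => b k i w * grid_incr k i w)) /\
    \int[P]_w (b k i w * grid_incr k i w) = 0.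
  apply: (@independent_mean0 R _ _ P (b k i) (grid_incr k i) (sg k) C) => //.
  - exact: grid_sg_neq0.
  - exact: (measurable_drift filF WW s0 sS mb).
  - exact: (measurable_grid_incr filF WW s0 sS mb).
  - exact: ind.
have intsum (I : finType) (f : I -> Omega -> R) :
    (forall i, P.-integrable setT (EFin \o f i)) ->
    P.-integrable setT (EFin \o (fun w => \sum_i f i w)) /\
    \int[P]_w (\sum_i f i w) = \sum_i \int[P]_w (f i w).
  move=> If; have -> : EFin \o (fun w => \sum_i f i w) =
      (fun w => \sum_i (EFin \o f i) w)%E.
    by apply/funext => w /=; rewrite sumEFin.
  split; first exact: integrable_sum.
  rewrite /Rintegral; under eq_integral do rewrite -sumEFin.
  rewrite integral_sum// sum_fine// => i _.
  by apply: integrable_fin_num => //; exact: If.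
have im k i : P.-integrable setT
    (EFin \o (fun w => b k i w * grid_incr k i w / (s k.+1 - s k))).
  have := integrableZr measurableT (s k.+1 - s k)^-1 (m0 k i).1.
  by apply: eq_integrable => // w _ /=; rewrite EFinM.
have im1 (k : 'I_L) := intsum _ _ (im k).
have [imm mE] : P.-integrable setT (EFin \o m) /\ \int[P]_w m w = 0.
  have [i1 i2] := intsum _ _ (fun k => (im1 k).1); split => //.
  rewrite i2 big1// => k _; rewrite (im1 k).2 big1// => i _.
  by rewrite RintegralZr ?(m0 k i).2 ?mul0r//; exact: (m0 k i).1.
have mc : measurable_fun setT c.
  apply: measurable_fun_sumr => k; apply: measurable_fun_sumr => i.
  by apply: measurable_funM => //; apply: measurable_funX; exact: (measurable_drift filF WW s0 sS mb).
have c0 w : 0 <= c w.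
  by do 2! apply: sumr_ge0 => ? _; rewrite divr_ge0 ?sqr_ge0// subr_ge0 ltW.
have ic : P.-integrable setT (EFin \o c).
  apply/integrableP; split; first exact/measurable_EFinP.
  under eq_integral do rewrite /= ger0_norm//.
  by apply: le_lt_trans bD _; rewrite ltry.
have cD : \int[P]_w c w <= D.
  by rewrite -lee_fin /Rintegral fineK// integrable_fin_num.
have ic2 : P.-integrable setT (EFin \o (fun w => 2^-1 * c w)).
  by have := integrableZl measurableT 2^-1 ic.
have iN : P.-integrable setT (EFin \o (fun w => - m w)).
  by have := integrableN imm.
have il : P.-integrable setT (EFin \o l).
  by have := integrableB measurableT iN ic2.
have ml : measurable_fun setT l by apply/measurable_EFinP; exact: measurable_int il.
have lint : \int[P]_w l w = - (\int[P]_w c w) / 2.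
  rewrite /l RintegralB// RintegralZl//.
  have -> : \int[P]_w (- m w) = 0.
    under eq_Rintegral do rewrite -mulN1r.
    by rewrite RintegralZl// mE mulr0.
  by rewrite sub0r mulNr mulrC.
have := entropy_inequality myA ml il a0.
under eq_integral do rewrite lE.
rewrite integral_grid_dens => /(_ erefl).
under eq_integral do rewrite lE.
rewrite AE lint; set X := ln _; move: X => X; lra.
Qed.

End path_girsanov.

(** * Grids and square-integrable functions *)

Section grids.
Context {R : realType}.

(** Unboundedness of the grid is kept as an invariant: it locates the next time to insert in some
    step. *)
Lemma grid_insert (s : nat -> R) (h t : R) :
  s 0%N = 0 -> (forall k, s k < s k.+1) -> (forall k, s k.+1 - s k <= h) ->
  (forall M, exists k, M < s k) -> 0 <= t ->
  exists s' : nat -> R,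
    [/\ s' 0%N = 0, forall k, s' k < s' k.+1, forall k, s' k.+1 - s' k <= h,
        forall M, exists k, M < s' k &
        (exists k, t = s' k) /\ forall j, exists k, s j = s' k].
Proof.
move=> s0 sS sh soo t0.
have ext : exists k, t < s k by exact: soo.
have [m tm mmin] := ex_minnP ext.
case: m tm mmin => [|m] tm mmin; first by move: tm; rewrite s0 ltNge t0.
have smt : s m <= t by rewrite leNgt; apply/negP => /mmin; rewrite ltnn.
(* A time already on the grid cannot be inserted again without losing strict monotonicity. *)
have [smE|smt'] := eqVneq (s m) t.
  by exists s; split => //; split; [exists m|move=> j; exists j].
have {}smt : s m < t by rewrite lt_neqAle smt'.
pose s' k := if (k <= m)%N then s k else if k == m.+1 then t else s k.-1.
have s'1 k : (k <= m)%N -> s' k = s k by rewrite /s' => ->.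
have s'2 : s' m.+1 = t by rewrite /s' ltnn eqxx.
have s'3 k : (m < k)%N -> s' k.+1 = s k.
  move=> mk; rewrite /s' ifF; last by apply/negbTE; rewrite -ltnNge ltnS ltnW.
  by rewrite ifF//; apply/negbTE; rewrite eqSS gtn_eqF.
exists s'; split.
- by rewrite s'1.
- move=> k; case: (ltngtP k m) => [km|mk|->].
  + by rewrite !s'1// ltnW.
  + rewrite (s'3 k)//; case: k mk => // k; rewrite ltnS leq_eqVlt => /predU1P[<-|mk].
      by rewrite s'2.
    by rewrite s'3.
  + by rewrite s'1// s'2.
- move=> k; case: (ltngtP k m) => [km|mk|->].
  + by rewrite !s'1// ltnW.
  + rewrite (s'3 k)//; case: k mk => // k; rewrite ltnS leq_eqVlt => /predU1P[<-|mk].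
      rewrite s'2; apply: le_trans (sh m); rewrite lerD2l lerN2; exact: ltW.
    by rewrite s'3.
  + rewrite (s'1 m)// s'2; apply: le_trans (sh m); rewrite lerD2r; exact: ltW.
- move=> M; have [k Mk] := soo M; case: (leqP k m) => km.
    by exists k; rewrite s'1.
  by exists k.+1; rewrite s'3.
- split; first by exists m.+1.
  move=> j; case: (leqP j m) => jm; first by exists j; rewrite s'1.
  by exists j.+1; rewrite s'3.
Qed.

(** The times of [S] are inserted one by one into the grid of multiples of [h]; splitting a step
    never enlarges the mesh. *)
Lemma grid_exists (S : seq R) (h : R) : 0 < h -> {in S, forall t, 0 <= t} ->
  exists (s : nat -> R) (L : nat),
    [/\ s 0%N = 0, forall k, s k < s k.+1, forall k, s k.+1 - s k <= h &
        forall t, t \in S -> exists2 k, (k <= L)%N & t = s k].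
Proof.
move=> h0 S0.
suff [s [s0 sS sh soo Ss]] : exists s : nat -> R, [/\ s 0%N = 0, forall k, s k < s k.+1,
   forall k, s k.+1 - s k <= h, forall M, exists k, M < s k &
   forall t, t \in S -> exists k, t = s k].
  suff [L LS] : exists L, forall t, t \in S -> exists2 k, (k <= L)%N & t = s k.
    by exists s, L.
  elim: S Ss {S0} => [|t S IH] Ss; first by exists 0%N.
  have [|L LS] := IH; first by move=> u uS; apply: Ss; rewrite inE uS orbT.
  have [k tk] := Ss t (mem_head _ _).
  exists (maxn k L) => u; rewrite inE => /predU1P[->|uS].
    by exists k => //; exact: leq_maxl.
  have [j jL uj] := LS u uS; exists j => //.
  by rewrite (leq_trans jL)// leq_maxr.
elim: S S0 => [|t S IH] S0.
  exists (fun k => k%:R * h); split => //.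
  - by rewrite mul0r.
  - by move=> k; rewrite ltr_pM2r// ltr_nat.
  - by move=> k; rewrite -mulrBl -natrB// subSnn mul1r.
  - move=> M; exists (Num.truncn (M / h)).+1.
    by rewrite -ltr_pdivrMr// truncnS_gt.
have [|s [s0 sS sh soo Ss]] := IH; first by move=> u uS; apply: S0; rewrite inE uS orbT.
have [|s' [s'0 s'S s'h s'oo [ts' ss']]] := grid_insert s0 sS sh soo (t := t).
  by apply: S0; rewrite mem_head.
exists s'; split => // u; rewrite inE => /predU1P[->//|/Ss[k ->]].
exact: ss'.
Qed.

End grids.

Section square_integrable.
Context {R : realType} {d : measure_display} {T : measurableType d}
  (mu : {measure set T -> \bar R}).

(** Integrates [2 c f <= f^2 + c^2] at [c = I / r]. Any upper bound [r] of the measure is allowed,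
    because a delayed time interval can be shorter than the grid step that divides the cost. *)
Lemma cauchy_schwarz_integral (f : T -> R) (D : set T) (r : R) :
  measurable D -> measurable_fun D f -> (mu D <= r%:E)%E -> 0 < r ->
  (\int[mu]_(x in D) (f x ^+ 2)%:E < +oo)%E ->
  mu.-integrable D (EFin \o f) /\
  ((fine (\int[mu]_(x in D) (f x)%:E)%E ^+ 2 / r)%:E <= \int[mu]_(x in D) (f x ^+ 2)%:E)%E.
Proof.
move=> mD mf Dr r0 f2.
have mf2 : measurable_fun D (fun x => f x ^+ 2) by exact: measurable_funX.
have muDoo : (mu D < +oo)%E by apply: le_lt_trans Dr _; rewrite ltry.
have ic (c : R) : mu.-integrable D (EFin \o (fun _ => c)).
  apply/integrableP; split; first exact: measurable_cst.
  rewrite (_ : (fun x => _) = cst (`|c|)%:E)// integral_cst//.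
  by rewrite lte_mul_pinfty// lee_fin.
have if2 : mu.-integrable D (EFin \o (fun x => f x ^+ 2)).
  apply/integrableP; split; first exact/measurable_EFinP.
  by under eq_integral do rewrite /= ger0_norm ?sqr_ge0//.
(* From [|f| <= 1 + f^2] on a set of finite measure. *)
have intf : mu.-integrable D (EFin \o f).
  have := integrableD mD (ic 1) if2; apply: le_integrable => //.
    exact/measurable_EFinP.
  move=> x _; rewrite /= lee_fin [leRHS]ger0_norm; last by rewrite addr_ge0// sqr_ge0.
  have := sqr_ge0 (`|f x| - 1); rewrite -(real_normK (num_real (f x))).
  have := normr_ge0 (f x); nra.
split => //.
set I := fine _; pose c := I / r.
have IE : \int[mu]_(x in D) f x = I by [].
have icf : mu.-integrable D (EFin \o (fun x => 2 * c * f x)).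
  by have := integrableZl mD (2 * c) intf.
have ifc : mu.-integrable D (EFin \o (fun x => f x ^+ 2 + c ^+ 2)).
  by have := integrableD mD if2 (ic (c ^+ 2)).
have := le_Rintegral mD icf ifc.
rewrite RintegralZl// IE RintegralD// Rintegral_cst//.
have -> : (\int[mu]_(x in D) (f x ^+ 2)%:E)%E = (\int[mu]_(x in D) (f x ^+ 2))%:E.
  by rewrite /Rintegral fineK// integrable_fin_num.
rewrite lee_fin => h.
have {}h : 2 * c * I <= \int[mu]_(x in D) (f x ^+ 2) + c ^+ 2 * fine (mu D).
  by apply: h => x _; have := sqr_ge0 (f x - c); nra.
have mr : fine (mu D) <= r by rewrite -lee_fin fineK// ge0_fin_numE.
have : c ^+ 2 * fine (mu D) <= c ^+ 2 * r by rewrite ler_wpM2l// sqr_ge0.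
have -> : c ^+ 2 * r = I ^+ 2 / r by rewrite /c; field; rewrite gt_eqF.
have : 2 * c * I = 2 * (I ^+ 2 / r) by rewrite /c; field; rewrite gt_eqF.
by move=> E1 E2; rewrite E1 in h; lra.
Qed.

End square_integrable.

(** * Time integrals of progressive processes *)

Section progressive.
Context {R : realType} {d0 : measure_display} {Omega : measurableType d0}
  (n : nat) (F : R -> set (set Omega)) (beta : 'I_n -> R -> Omega -> R).
Hypotheses (filF : filtration F) (pb : prog_measurable F beta).
Local Notation mu := (@lebesgue_measure R).
Local Notation Om t := (g_sigma_algebraType (F t)).
Local Notation strip t :=
  ((`[0, t]%classic : set (measurableTypeR R)) `*` setT : set (measurableTypeR R * Om t)).
Implicit Types (t u : R) (w : Omega).

Definition speed2 t w := \sum_(i < n) beta i t w ^+ 2.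
Definition energy t w : \bar R := (\int[mu]_(r in `[0%R, t]%classic) (speed2 r w)%:E)%E.
Definition total_energy w : \bar R :=
  (\int[mu]_(r in `[0%R, +oo[%classic) (speed2 r w)%:E)%E.

Lemma speed2_ge0 t w : 0 <= speed2 t w.
Proof. by apply: sumr_ge0 => i _; exact: sqr_ge0. Qed.

(** The trace sigma-algebra spelled out in [prog_measurable] is contained in the product
    sigma-algebra, for which Tonelli's theorem is available. *)
Lemma prog_measurable_fun t i : 0 <= t ->
  measurable_fun (strip t)
    (fun p : measurableTypeR R * Om t => beta i p.1 p.2).
Proof.
move=> t0 mD U mU; have [sF _ _] := filF.
have := pb t0 i mU; move: (_ `&` _); apply: smallest_sub.
  split=> //.
  - by move=> A mA; exact: measurableD.
  - by move=> A mA; exact: bigcupT_measurable.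
move=> _ [B [A [mB _ FA ->]]]; apply: measurableX => //.
exact: sub_sigma_algebra.
Qed.

Lemma measurable_speed2 t : 0 <= t ->
  measurable_fun (strip t)
    (fun p : measurableTypeR R * Om t => speed2 p.1 p.2).
Proof.
move=> t0; apply: measurable_fun_sumr => i; apply: measurable_funX.
exact: prog_measurable_fun.
Qed.

(** Tonelli's theorem for Lebesgue measure and the sigma-algebra [F t]. The integrand, measurable
    only up to time [t], is extended by zero outside [D]. *)
Lemma measurable_time_integral t (D : set R) (f : R -> Omega -> R) : 0 <= t ->
  measurable D -> D `<=` `[0, t]%classic ->
  measurable_fun (strip t)
    (fun p : measurableTypeR R * Om t => f p.1 p.2) ->
  (forall r w, 0 <= f r w) ->
  measurable_fun setT (fun w : Om t => \int[mu]_(r in D) (f r w)%:E)%E.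
Proof.
move=> t0 mD Dt mf f0.
pose h (p : measurableTypeR R * Om t) : \bar R :=
  ((fun p : measurableTypeR R * Om t => (f p.1 p.2)%:E) \_ (D `*` setT)) p.
have mDT : measurable (D `*` setT : set (measurableTypeR R * Om t)) by exact: measurableX.
have mh : measurable_fun setT h.
  apply/(measurable_restrictT _ mDT).
  apply/measurable_EFinP; apply: (measurable_funS _ _ mf); first exact: measurableX.
  by move=> [r w] [/Dt].
have h0 p : (0 <= h p)%E by apply: erestrict_ge0 => q _; rewrite lee_fin.
have := measurable_fun_fubini_tonelli_G (m1 := mu) h mh h0.
congr measurable_fun; apply/funext => w; rewrite /fubini_G [RHS]integral_mkcond.
apply: eq_integral => r _; rewrite /h !patchE in_setX/= in_setT andbT.
by [].
Qed.

(** The integral of a signed function is by definition the difference of the integrals of its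
    positive and negative parts, and each of these is measurable by Tonelli's theorem. *)
Lemma measurable_time_integralR t (D : set R) i : 0 <= t ->
  measurable D -> D `<=` `[0, t]%classic ->
  measurable_fun setT (fun w : Om t => fine (\int[mu]_(r in D) (beta i r w)%:E)%E).
Proof.
move=> t0 mD Dt; apply: measurableT_comp => //.
have mb := prog_measurable_fun i t0.
have mbN : measurable_fun (strip t) (fun p => - beta i p.1 p.2) by exact: measurableT_comp.
have mp : measurable_fun setT
    (fun w : Om t => \int[mu]_(r in D) (Num.max (beta i r w) 0)%:E)%E.
  apply: (measurable_time_integral (f := fun r w => Num.max (beta i r w) 0)) => //.
    by apply: measurable_maxr; [exact: mb|exact: measurable_cst].
  by move=> r w; rewrite le_max lexx orbT.
have mn : measurable_fun setT
    (fun w : Om t => \int[mu]_(r in D) (Num.max (- beta i r w) 0)%:E)%E.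
  apply: (measurable_time_integral (f := fun r w => Num.max (- beta i r w) 0)) => //.
    by apply: measurable_maxr; [exact: mbN|exact: measurable_cst].
  by move=> r w; rewrite le_max lexx orbT.
have := emeasurable_funB mp mn; congr measurable_fun.
apply/funext => w /=; rewrite [RHS]integralE; congr (_ - _)%E.
  by apply: eq_integral => r _; rewrite funeposE EFin_max.
by apply: eq_integral => r _; rewrite funenegE EFin_max.
Qed.

Lemma measurable_energyF t u : 0 <= t -> u <= t ->
  measurable_fun setT (fun w : Om t => energy u w).
Proof.
move=> t0 ut; apply: (measurable_time_integral (f := speed2)) => //.
- by move=> r /=; rewrite !in_itv/= => /andP[-> /le_trans ->].
- exact: measurable_speed2.
- by move=> *; exact: speed2_ge0.
Qed.

Lemma measurable_section t (f : R -> Omega -> R) w :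
  measurable_fun (strip t)
    (fun p : measurableTypeR R * Om t => f p.1 p.2) ->
  measurable_fun `[0, t]%classic (f ^~ w).
Proof.
move=> mf _ U mU.
have mI : measurable (`[0, t]%classic : set (measurableTypeR R)) by exact: measurable_itv.
have mD : measurable (strip t).
  by apply: measurableX.
have := measurable_ysection (w : Om t) (mf mD U mU).
congr measurable; apply/seteqP; split => r /=; rewrite /ysection /= inE/=.
  by move=> [[]].
by move=> [].
Qed.

Lemma measurable_beta_path i w : measurable_fun (`[0, +oo[%classic : set R) (fun r => beta i r w).
Proof.
have -> : `[0, +oo[%classic = \bigcup_k `[0, k%:R]%classic :> set R.
  apply/seteqP; split => r /=; last by move=> [k _] /=; rewrite !in_itv/= => /andP[->].
  rewrite in_itv/= andbT => r0; exists (Num.truncn r).+1 => //=.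
  by rewrite in_itv/= r0/= ltW// truncnS_gt.
apply/measurable_fun_bigcup; first by move=> k; exact: measurable_itv.
by move=> k; apply: measurable_section; exact: prog_measurable_fun.
Qed.

Lemma measurable_speed2_path w : measurable_fun (`[0, +oo[%classic : set R) (fun r => speed2 r w).
Proof.
apply: measurable_fun_sumr => i; apply: measurable_funX.
exact: measurable_beta_path.
Qed.

Lemma measurable_of_sub t (f : Omega -> \bar R) : 0 <= t ->
  measurable_fun setT (f : Om t -> \bar R) -> measurable_fun setT f.
Proof.
move=> t0 mf _ U mU; have [sF mF _] := filF.
have := mf measurableT U mU; rewrite !setTI /measurable/= => h.
by apply: (mF t t0); rewrite -(sigma_algebra_id (sF t t0)).
Qed.

Lemma measurable_total_energy : measurable_fun setT total_energy.
Proof.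
have me k : measurable_fun setT (energy k%:R).
  by apply: (@measurable_of_sub k%:R) => //; exact: measurable_energyF.
apply: (emeasurable_fun_cvg (fun k => energy k%:R)) => // w _.
rewrite /total_energy (_ : `[0, +oo[%classic = \bigcup_k `[0, k%:R]%classic :> set R); last first.
  apply/seteqP; split => r /=; last by move=> [k _] /=; rewrite !in_itv/= => /andP[->].
  rewrite in_itv/= andbT => r0; exists (Num.truncn r).+1 => //=.
  by rewrite in_itv/= r0/= ltW// truncnS_gt.
apply: ge0_nondecreasing_set_cvg_integral.
- move=> i j ij; apply/subsetPset => r /=; rewrite !in_itv/= => /andP[-> /le_trans]; apply.
  by rewrite ler_nat.
- by move=> k; exact: measurable_itv.
- move=> k; apply/measurable_EFinP.
  apply: measurable_funS (measurable_speed2_path w) => //.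
  by move=> r /=; rewrite !in_itv/= => /andP[->].
- by move=> k r _; rewrite lee_fin speed2_ge0.
Qed.

Lemma subset_integral_speed2 (A B : set R) w : measurable A -> measurable B ->
  A `<=` B -> B `<=` `[0, +oo[%classic ->
  (\int[mu]_(r in A) (speed2 r w)%:E <= \int[mu]_(r in B) (speed2 r w)%:E)%E.
Proof.
move=> mA mB AB B0; apply: ge0_subset_integral => //.
  by apply/measurable_EFinP; exact: (measurable_funS _ B0 (measurable_speed2_path w)).
by move=> r _; rewrite lee_fin speed2_ge0.
Qed.

Lemma energy_le_total t w : (energy t w <= total_energy w)%E.
Proof.
apply: subset_integral_speed2 => //.
by move=> r /=; rewrite !in_itv/= => /andP[->].
Qed.

Lemma energy_le t u w : t <= u -> (energy t w <= energy u w)%E.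
Proof.
move=> tu; apply: subset_integral_speed2 => //.
  by move=> r /=; rewrite !in_itv/= => /andP[-> /le_trans ->].
by move=> r /=; rewrite !in_itv/= => /andP[->].
Qed.

Lemma energyD t u w : 0 <= t -> t <= u ->
  (energy u w = energy t w + \int[mu]_(r in `]t, u]%classic) (speed2 r w)%:E)%E.
Proof.
move=> t0 tu; rewrite /energy -ge0_integral_setU//.
- by rewrite -itv_bndbnd_setU// bnd_simp.
- apply/measurable_EFinP; rewrite -itv_bndbnd_setU ?bnd_simp//.
  apply: measurable_funS (measurable_speed2_path w) => //.
  by move=> r /=; rewrite !in_itv/= => /andP[->].
- by move=> r _; rewrite lee_fin speed2_ge0.
- apply/disj_setPS => r [] /=; rewrite !in_itv/= => /andP[_ rt] /andP[tr _].
  by move: (le_lt_trans rt tr); rewrite ltxx.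
Qed.

Lemma drift_square_le i t u (r : R) w : 0 <= t -> t <= u -> u - t <= r -> 0 < r ->
  (\int[mu]_(x in `]t, u]%classic) (speed2 x w)%:E < +oo)%E ->
  mu.-integrable `]t, u]%classic (EFin \o (fun x => beta i x w)) /\
  ((fine (\int[mu]_(x in `]t, u]%classic) (beta i x w)%:E)%E ^+ 2 / r)%:E <=
    \int[mu]_(x in `]t, u]%classic) (beta i x w ^+ 2)%:E)%E.
Proof.
move=> t0 tu utr r0 foo.
have sub0 : `]t, u]%classic `<=` (`[0, +oo[%classic : set R).
  by move=> x /=; rewrite !in_itv/= andbT => /andP[tx _]; rewrite (le_trans t0)// ltW.
have hmu : (mu `]t, u]%classic <= r%:E)%E.
  rewrite lebesgue_measure_itv/= lte_fin; case: ifP => _; first by rewrite -EFinB lee_fin.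
  by rewrite lee_fin ltW.
apply: cauchy_schwarz_integral => //.
- by apply: measurable_funS (measurable_beta_path i w) => //.
- apply: le_lt_trans foo; apply: ge0_le_integral => //.
  + by move=> x _; rewrite lee_fin sqr_ge0.
  + apply/measurable_EFinP; apply: measurable_funX.
    by apply: measurable_funS (measurable_beta_path i w) => //.
  + apply/measurable_EFinP.
    by apply: measurable_funS (measurable_speed2_path w) => //.
  + move=> x _; rewrite lee_fin /speed2 (bigD1 i)//= lerDl.
    by apply: sumr_ge0 => j _; exact: sqr_ge0.
Qed.

Lemma sum_drift_square_le t u (r : R) w : 0 <= t -> t <= u -> u - t <= r -> 0 < r ->
  (\int[mu]_(x in `]t, u]%classic) (speed2 x w)%:E < +oo)%E ->
  ((\sum_(i < n) fine (\int[mu]_(x in `]t, u]%classic) (beta i x w)%:E)%E ^+ 2 / r)%:E <=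
    \int[mu]_(x in `]t, u]%classic) (speed2 x w)%:E)%E.
Proof.
move=> t0 tu utr r0 foo.
have sub0 : `]t, u]%classic `<=` (`[0, +oo[%classic : set R).
  by move=> x /=; rewrite !in_itv/= andbT => /andP[tx _]; rewrite (le_trans t0)// ltW.
under [leRHS]eq_integral do rewrite /speed2 -sumEFin.
rewrite ge0_integral_sum//; last 2 first.
- move=> i; apply/measurable_EFinP; apply: measurable_funX.
  by apply: measurable_funS (measurable_beta_path i w) => //.
- by move=> i x _; rewrite lee_fin sqr_ge0.
by rewrite -sumEFin; apply: lee_sum => i _; exact: (drift_square_le i t0 tu utr r0 foo).2.
Qed.

End progressive.

(** * Delayed drift *)

Section delayed_drift.
Context {R : realType} {d0 : measure_display} {Omega : measurableType d0}
  (n : nat) (F : R -> set (set Omega)) (beta : 'I_n -> R -> Omega -> R).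
Hypotheses (filF : filtration F) (pb : prog_measurable F beta).
Local Notation mu := (@lebesgue_measure R).
Local Notation Om t := (g_sigma_algebraType (F t)).
Local Notation energy := (energy beta).
Local Notation total_energy := (total_energy beta).
Local Notation speed2 := (speed2 beta).

(** Half-open intervals make consecutive steps disjoint, so that the integrals add up. *)
Definition drift_integral i (t u : R) w : R :=
  fine (\int[mu]_(x in `]t, u]%classic) (beta i x w)%:E)%E.

Lemma drift_energy_le t u v w : 0 <= t -> u <= v ->
  (\int[mu]_(x in `]t, u]%classic) (speed2 x w)%:E <= energy v w)%E.
Proof.
move=> t0 uv; apply: (subset_integral_speed2 filF pb) => //.
  by move=> x /=; rewrite !in_itv/= => /andP[/ltW tx /le_trans ->//]; rewrite (le_trans t0).
by move=> x /=; rewrite !in_itv/= => /andP[->].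
Qed.

Lemma drift_integrable i t u v w (K : R) : 0 <= t -> t <= u -> u <= v ->
  (energy v w <= K%:E)%E ->
  mu.-integrable `]t, u]%classic (EFin \o (fun x => beta i x w)).
Proof.
move=> t0 tu uv eK.
apply: (drift_square_le filF pb i (r := u - t + 1) t0 tu _ _ _).1.
- by rewrite lerDl.
- by rewrite ltr_pwDr// subr_ge0.
- by apply: le_lt_trans (drift_energy_le w t0 uv) (le_lt_trans eK _); rewrite ltry.
Qed.

Lemma drift_integralD i t u v w (K : R) : 0 <= t -> t <= u -> u <= v ->
  (energy v w <= K%:E)%E ->
  drift_integral i t v w = drift_integral i t u w + drift_integral i u v w.
Proof.
move=> t0 tu uv eK; have tv := le_trans tu uv.
have vv := lexx v.
have iv := drift_integrable i t0 tv vv eK.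
have E : `]t, v]%classic = `]t, u]%classic `|` `]u, v]%classic :> set R.
  by rewrite -itv_bndbnd_setU// bnd_simp.
have := @Rintegral_setU _ _ _ mu `]t, u]%classic `]u, v]%classic (fun x => beta i x w).
rewrite /Rintegral -E; apply => //.
apply/disj_setPS => r [] /=; rewrite !in_itv/= => /andP[_ rt] /andP[tr _].
by move: (le_lt_trans rt tr); rewrite ltxx.
Qed.

(** By Cauchy-Schwarz, with energy at most [K] the drift moves each coordinate by at most
    [sqrt (K r)] during a time [r]. This bounds both the delayed drift of one step and the error of
    the delayed path. *)
Lemma drift_integral_sqr_le i t u v w (r K : R) : 0 <= t -> t <= u -> u <= v ->
  u - t <= r -> 0 < r -> (energy v w <= K%:E)%E ->
  drift_integral i t u w ^+ 2 <= K * r.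
Proof.
move=> t0 tu uv utr r0 eK.
have eoo : (\int[mu]_(x in `]t, u]%classic) (speed2 x w)%:E < +oo)%E.
  by apply: le_lt_trans (drift_energy_le w t0 uv) (le_lt_trans eK _); rewrite ltry.
rewrite -ler_pdivrMr// -lee_fin.
apply: le_trans eK; apply: le_trans (drift_energy_le w t0 uv).
apply: le_trans (sum_drift_square_le filF pb t0 tu utr r0 eoo).
rewrite lee_fin (bigD1 i)//= lerDl sumr_ge0// => j _.
by rewrite divr_ge0 ?sqr_ge0// ltW.
Qed.

Lemma xi_drift (W : 'I_n -> R -> Omega -> R) i t w :
  xi_of beta W w i t = drift_integral i 0 t w + W i t w.
Proof.
rewrite /xi_of /drift_integral integral_itv_obnd_cbnd//.
apply/measurable_EFinP; apply: measurable_funS (measurable_beta_path filF pb i w) => //.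
by move=> x /=; rewrite !in_itv/= => /andP[/ltW ->].
Qed.

Variables (s : nat -> R) (h K : R).
Hypotheses (s0 : s 0%N = 0) (sS : forall k, s k < s k.+1)
  (sh : forall k, s k.+1 - s k <= h) (h0 : 0 < h) (K0 : 0 < K).

(* Delaying the drift by [h], which dominates the mesh, makes the drift over
   the step from [s k] to [s k.+1] known at time [s k]. *)
Definition delayed k := Num.max 0 (s k - h).

Definition low_energy t : set Omega := energy t @^-1` `]-oo, K%:E]%classic.

(** The indicator reads the energy up to [s k] only, hence is known at time [s k]. It equals 1 at
    every step when the total energy is at most [K]. *)
Definition delayed_drift k i w : R :=
  \1_(low_energy (s k)) w * drift_integral i (delayed k) (delayed k.+1) w.

Lemma delayed_ge0 k : 0 <= delayed k.
Proof. by rewrite le_max lexx. Qed.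

Lemma delayed0 : delayed 0 = 0.
Proof. by rewrite /delayed s0 sub0r; apply/max_idPl; rewrite oppr_le0 ltW. Qed.

Lemma delayed_le k : delayed k <= s k.
Proof.
rewrite /delayed ge_max (grid_ge0 s0 sS)/=; have := h0; lra.
Qed.

Lemma delayedS k : delayed k <= delayed k.+1.
Proof. by rewrite ge_max !le_max lexx/=; apply/orP; right; have := sS k; lra. Qed.

Lemma delayedS_le k : delayed k.+1 <= s k.
Proof. by rewrite ge_max (grid_ge0 s0 sS)/=; have := sh k; lra. Qed.

(** The maximum with 0 is 1-Lipschitz. Hence the cost, with the grid step as denominator, is still
    bounded by the energy over the delayed interval. *)
Lemma delayedB_le k : delayed k.+1 - delayed k <= s k.+1 - s k.
Proof.
have := sS k; rewrite lerBlDr /delayed; case: (leP 0 (s k.+1 - h)) => h1;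
  by case: (leP 0 (s k - h)) => h2; lra.
Qed.

Lemma delayed_lag k : s k - delayed k <= h.
Proof. by have := h0; rewrite /delayed; case: (leP 0 (s k - h)) => h1; lra. Qed.

Lemma low_energyP t w : reflect (low_energy t w) (energy t w <= K%:E)%E.
Proof. by apply: (iffP idP); rewrite /low_energy/= in_itv. Qed.

Lemma delayed_driftE k i w : (energy (s k) w <= K%:E)%E ->
  delayed_drift k i w = drift_integral i (delayed k) (delayed k.+1) w.
Proof. by move=> /low_energyP e; rewrite /delayed_drift indicE mem_set// mul1r. Qed.

Lemma delayed_drift0 k i w : ~ (energy (s k) w <= K%:E)%E -> delayed_drift k i w = 0.
Proof.
by move=> ne; rewrite /delayed_drift indicE memNset ?mul0r// => /low_energyP.
Qed.

Lemma delayed_drift_adapted k i (U : set R) : measurable U ->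
  F (s k) (delayed_drift k i @^-1` U).
Proof.
move: U; have sk0 := grid_ge0 s0 sS k; have [sF _ _] := filF.
apply/(measurable_fun_g_sigma (delayed_drift k i) (sF _ sk0)).
apply: measurable_funM.
  apply: measurable_indic.
  have me := measurable_energyF filF pb sk0 (lexx (s k)).
  exact: (measurable_preimageT me (emeasurable_itv _)).
apply: (measurable_time_integralR filF pb) => //.
move=> x /=; rewrite !in_itv/= => /andP[lx xu].
by rewrite (le_trans (delayed_ge0 k) (ltW lx)) (le_trans xu (delayedS_le k)).
Qed.

(** From the bound [K h] on the square, by [|x| <= 1 + x^2]. A uniform bound of any size serves to
    make the stochastic integral integrable. *)
Lemma delayed_drift_bounded k i w : `|delayed_drift k i w| <= 1 + K * h.
Proof.
have Kh : 0 <= K * h by rewrite mulr_ge0// ltW.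
have [e|ne] := pselect (energy (s k) w <= K%:E)%E; last first.
  by rewrite delayed_drift0// normr0 addr_ge0.
rewrite delayed_driftE//.
have := drift_integral_sqr_le i (delayed_ge0 k) (delayedS k) (delayedS_le k)
  (le_trans (delayedB_le k) (sh k)) h0 e.
set x := drift_integral _ _ _ _; rewrite -(real_normK (num_real x)).
by have := normr_ge0 x; nra.
Qed.

(** The induction works with the energy up to [delayed L] in place of the total energy. If the
    indicator at step [L] is off, nothing is added. If it is on, the whole cost so far is at most
    the energy up to [delayed L.+1], itself at most the energy up to [s L], hence at most [K]. *)
Lemma delayed_cost_le L w :
  ((\sum_(k < L) \sum_(i < n) delayed_drift k i w ^+ 2 / (s k.+1 - s k))%:E <=
   mine K%:E (total_energy w))%E.
Proof.
apply: (@le_trans _ _ (mine K%:E (energy (delayed L) w))); last first.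
  rewrite le_min ge_min lexx/= ge_min; apply/orP; right.
  exact: (energy_le_total filF pb).
elim: L => [|L IH].
  rewrite big_ord0 le_min lee_fin (ltW K0)/=; apply: integral_ge0 => x _.
  by rewrite lee_fin speed2_ge0.
rewrite big_ord_recr/=.
have [e|ne] := pselect (energy (s L) w <= K%:E)%E; last first.
  rewrite [X in _ + X]big1 ?addr0; last first.
    by move=> i _; rewrite delayed_drift0// expr0n/= mul0r.
  apply: le_trans IH _; rewrite le_min ge_min lexx/= ge_min; apply/orP; right.
  exact: (energy_le filF pb _ (delayedS L)).
have eL1 : (energy (delayed L.+1) w <= K%:E)%E.
  exact: le_trans (energy_le filF pb _ (delayedS_le L)) e.
rewrite le_min andbC; apply/andP.
suff X : ((\sum_(k < L) \sum_(i < n) delayed_drift k i w ^+ 2 / (s k.+1 - s k) +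
   \sum_(i < n) delayed_drift L i w ^+ 2 / (s L.+1 - s L))%:E <= energy (delayed L.+1) w)%E.
  by split => //; exact: le_trans X eL1.
rewrite EFinD (energyD filF pb _ (delayed_ge0 L) (delayedS L)); apply: leeD.
  by apply: le_trans IH _; rewrite ge_min lexx orbT.
under eq_bigr do rewrite delayed_driftE//.
apply: (sum_drift_square_le filF pb) => //.
- exact: delayed_ge0.
- exact: delayedS.
- exact: delayedB_le.
- by rewrite subr_gt0.
- apply: le_lt_trans (drift_energy_le w (delayed_ge0 L) (delayedS_le L)) _.
  by apply: le_lt_trans e _; rewrite ltry.
Qed.

Lemma sum_delayed_drift m i w : (total_energy w <= K%:E)%E ->
  \sum_(k < m) delayed_drift k i w = drift_integral i 0 (delayed m) w.
Proof.
move=> EK; have eK t := le_trans (energy_le_total filF pb t w) EK.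
elim: m => [|m IH].
  by rewrite big_ord0 delayed0 /drift_integral set_itvoc0 integral_set0.
rewrite big_ord_recr/= IH delayed_driftE//.
by rewrite -(drift_integralD i _ (delayed_ge0 m) (delayedS m) (eK (delayed m.+1))).
Qed.

(** The drift of a step is added all at once at its right end; the comparison with [xi] is made at
    grid times only. *)
Definition delayed_path (W : 'I_n -> R -> Omega -> R) L w i t : R :=
  W i t w + \sum_(k < L | s k.+1 <= t) delayed_drift k i w.

Lemma delayed_path_grid W L m w i : (m <= L)%N ->
  delayed_path W L w i (s m) = W i (s m) w + \sum_(k < m) delayed_drift k i w.
Proof.
move=> mL; congr (_ + _); rewrite (big_ord_widen L (fun k => delayed_drift k i w))//.
apply: eq_bigl => k; apply/idP/idP => [|km].
  by apply: contraTT; rewrite -ltNge -leqNgt => mk; rewrite (le_lt_trans (grid_le sS mk)).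
exact: (grid_le sS).
Qed.

(** At a grid time the two paths differ by the drift from [delayed m] to [s m], a stretch of length
    at most [h]. *)
Lemma delayed_path_error W L m w i : (m <= L)%N -> (total_energy w <= K%:E)%E ->
  (delayed_path W L w i (s m) - xi_of beta W w i (s m)) ^+ 2 <= K * h.
Proof.
move=> mL EK; have eK t := le_trans (energy_le_total filF pb t w) EK.
rewrite delayed_path_grid// sum_delayed_drift// xi_drift.
rewrite (drift_integralD i (lexx 0) (delayed_ge0 m) (delayed_le m) (eK (s m))).
rewrite [X in X ^+ 2](_ : _ = - drift_integral i (delayed m) (s m) w); last by lra.
rewrite sqrrN; apply: (@drift_integral_sqr_le i _ _ (s m)) => //.
- exact: delayed_ge0.
- exact: delayed_le.
- exact: delayed_lag.
Qed.

End delayed_drift.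

(** * Approximation of the drifted process at finitely many times *)

Section delayed_approximation.
Context {R : realType} {d0 : measure_display} {Omega : measurableType d0}
  (n : nat) (P : probability Omega R) (F : R -> set (set Omega))
  (W beta : 'I_n -> R -> Omega -> R).
Hypotheses (filF : filtration F) (WW : is_Wiener P F W) (pb : prog_measurable F beta).

Lemma delayed_approximation (S : seq R) (K eta : R) : 0 < K -> 0 < eta ->
  {in S, forall t, 0 <= t} ->
  exists y : Omega -> 'I_n -> R -> R,
    (forall A, fin_sigma S A -> measurable (y @^-1` A) /\
       forall a D : R, 0 <= a ->
         (\int[P]_w mine K%:E (total_energy beta w) <= D%:E)%E ->
         a * fine (P (y @^-1` A)) <=
         D / 2 + ln (1 + fine (P (path_of W @^-1` A)) * (expR a - 1))) /\
    (forall w, (total_energy beta w <= K%:E)%E -> forall i t, t \in S ->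
       `|y w i t - xi_of beta W w i t| <= eta).
Proof.
(* Chosen so that the bound [K * h] on the squared error equals [eta ^+ 2]. *)
move=> K0 eta0 S0; pose h := eta ^+ 2 / K.
have h0 : 0 < h by rewrite divr_gt0// exprn_gt0.
have [s [L [s0 sS sh Ss]]] := grid_exists h0 S0.
pose b := delayed_drift beta s h K.
have mb k i (U : set R) : measurable U -> F (s k) (b k i @^-1` U).
  exact: (delayed_drift_adapted filF pb K s0 sS sh).
pose y := delayed_path beta s h K W L.
have [_ W0 _ _] := WW.
have y0 w i : y w i 0 = 0.
  rewrite /y /delayed_path W0 add0r big1// => k.
  by rewrite leNgt (le_lt_trans (grid_ge0 s0 sS k)).
have yS k : (k < L)%N -> forall w i,
    y w i (s k.+1) - y w i (s k) = grid_incr W s k i w + b k i w.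
  move=> kL w i; rewrite /y !delayed_path_grid//; last exact: ltnW.
  by rewrite big_ord_recr/= /grid_incr -/(b k i w); lra.
exists y; split.
  move=> A SA; have [myA _ _] := girsanov_fin filF WW s0 sS mb y0 yS Ss SA.
  split => // a D a0 DE.
  apply: (grid_entropy filF WW s0 sS mb y0 yS Ss SA a0 (C := 1 + K * h)).
    by move=> k i w; exact: (delayed_drift_bounded filF pb s0 sS sh h0 K0).
  apply: le_trans DE; apply: ge0_le_integral => //.
  - move=> w _; rewrite lee_fin; do 2! apply: sumr_ge0 => ? _.
    by rewrite divr_ge0 ?sqr_ge0// subr_ge0 ltW.
  - apply/measurable_EFinP; apply: measurable_fun_sumr => k; apply: measurable_fun_sumr => i.
    apply: measurable_funM => //; apply: measurable_funX.
    exact: (measurable_drift filF WW s0 sS mb).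
  - apply: measurable_mine; first exact: measurable_cst.
    exact: (measurable_total_energy filF pb).
  - by move=> w _; exact: (delayed_cost_le filF pb s0 sS sh K0).
move=> w EK i t /Ss[m mL ->].
have : (y w i (s m) - xi_of beta W w i (s m)) ^+ 2 <= K * h.
  exact: (delayed_path_error filF pb s0 sS).
rewrite (_ : K * h = eta ^+ 2); last by rewrite /h; field; rewrite gt_eqF.
rewrite -[X in X <= _ -> _](real_normK (num_real _)).
by rewrite ler_pXn2r ?nnegrE// ltW.
Qed.

End delayed_approximation.

(** * Outer regularity on path space *)

Section probability_tools.
Context {R : realType} {d0 : measure_display} {Omega : measurableType d0}
  (P : probability Omega R).

Lemma fin_num_prob A : measurable A -> P A \is a fin_num.
Proof. by move=> mA; exact: fin_num_measure. Qed.

Lemma le_prob A B : measurable A -> measurable B -> A `<=` B -> fine (P A) <= fine (P B).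
Proof.
move=> mA mB AB; apply: fine_le; rewrite ?fin_num_prob//.
by apply: le_measure; rewrite ?inE.
Qed.

Lemma prob_ge0 A : 0 <= fine (P A).
Proof. exact: fine_ge0. Qed.

Lemma prob_le1 A : measurable A -> fine (P A) <= 1.
Proof.
by move=> mA; rewrite -lee_fin fineK ?fin_num_prob//; exact: probability_le1.
Qed.

Lemma prob_setU_le A B : measurable A -> measurable B ->
  fine (P (A `|` B)) <= fine (P A) + fine (P B).
Proof.
move=> mA mB; rewrite -lee_fin EFinD !fineK ?fin_num_prob//; last exact: measurableU.
exact: measureU2.
Qed.

Lemma prob_setC A : measurable A -> fine (P (~` A)) = 1 - fine (P A).
Proof.
by move=> mA; rewrite probability_setC// fineB ?fin_num_prob.
Qed.

Lemma prob_bigcup_le (G : nat -> set Omega) (c : R) :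
  (forall k, measurable (G k)) -> {homo G : i j / (i <= j)%N >-> i `<=` j} ->
  (forall k, fine (P (G k)) <= c) -> fine (P (\bigcup_k G k)) <= c.
Proof.
move=> mG ndG Gc; have mU : measurable (\bigcup_k G k) by exact: bigcupT_measurable.
rewrite -lee_fin fineK ?fin_num_prob//.
have cv : P (G k) @[k --> \oo] --> P (\bigcup_k G k).
  by apply: nondecreasing_cvg_mu => // i j ij; apply/subsetPset; exact: ndG.
rewrite -(cvg_lim _ cv)//; apply: lime_le; first by apply/cvg_ex; exists (P (\bigcup_k G k)).
by apply: nearW => k; rewrite -(fineK (fin_num_prob (mG k))) lee_fin.
Qed.

Lemma prob_bigcup_approx (G : nat -> set Omega) (e : R) :
  (forall k, measurable (G k)) -> {homo G : i j / (i <= j)%N >-> i `<=` j} -> 0 < e ->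
  exists k, fine (P (\bigcup_k G k)) - e < fine (P (G k)).
Proof.
move=> mG ndG e0; apply: contrapT => h.
have : fine (P (\bigcup_k G k)) <= fine (P (\bigcup_k G k)) - e.
  apply: prob_bigcup_le => // k; rewrite leNgt; apply/negP => hk.
  by apply: h; exists k.
lra.
Qed.

End probability_tools.

(** * Open cylinders and their increasing unions *)

Section open_cylinders.
Context {R : realType} (n : nat).
Local Notation path := ('I_n -> R -> R).
Implicit Types (S : seq R) (U V : set path).

(** The radius may depend on the path [x]. Measurability is a component of the definition, which
    spares the proof that open sets of a finite product are Borel. *)
Definition fin_open S U := [/\ {in S, forall t, 0 <= t}, fin_sigma S U &
  forall x, U x -> exists2 e : R, 0 < e &
    forall y : path, (forall i t, t \in S -> `|y i t - x i t| < e) -> U y].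

Lemma fin_sigmaS S S' U : {subset S <= S'} -> fin_sigma S U -> fin_sigma S' U.
Proof.
move=> SS'; apply: sub_sigma_algebra2 => _ [i [t [B [tS mB ->]]]].
by exists i, t, B; split => //; exact: SS'.
Qed.

Lemma fin_openI S S' U V : fin_open S U -> fin_open S' V -> fin_open (S ++ S') (U `&` V).
Proof.
move=> [S0 sU oU] [S'0 sV oV]; split.
- by move=> t; rewrite mem_cat => /orP[/S0|/S'0].
- have sU' : fin_sigma (S ++ S') U by apply: fin_sigmaS sU => t; rewrite mem_cat => ->.
  have sV' : fin_sigma (S ++ S') V by apply: fin_sigmaS sV => t; rewrite mem_cat orbC => ->.
  exact: (@measurableI _ (g_sigma_algebraType _) _ _ sU' sV').
- move=> x [/oU[e e0 eU] /oV[e' e'0 e'V]].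
  exists (Num.min e e'); first by rewrite lt_min e0.
  move=> y hy; split; [apply: eU|apply: e'V] => i t tS.
    by have := hy i t; rewrite mem_cat tS lt_min => /(_ isT) /andP[].
  by have := hy i t; rewrite mem_cat tS orbT lt_min => /(_ isT) /andP[].
Qed.

Lemma fin_openU S S' U V : fin_open S U -> fin_open S' V -> fin_open (S ++ S') (U `|` V).
Proof.
move=> [S0 sU oU] [S'0 sV oV]; split.
- by move=> t; rewrite mem_cat => /orP[/S0|/S'0].
- have sU' : fin_sigma (S ++ S') U by apply: fin_sigmaS sU => t; rewrite mem_cat => ->.
  have sV' : fin_sigma (S ++ S') V by apply: fin_sigmaS sV => t; rewrite mem_cat orbC => ->.
  exact: (@measurableU _ (g_sigma_algebraType _) _ _ sU' sV').
- move=> x [/oU[e e0 eU]|/oV[e e0 eV]]; exists e => // y hy.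
    by left; apply: eU => i t tS; apply: hy; rewrite mem_cat tS.
  by right; apply: eV => i t tS; apply: hy; rewrite mem_cat tS orbT.
Qed.

Lemma fin_open0 : fin_open [::] set0.
Proof. by split => //; exact: sigma_algebra0. Qed.

Lemma fin_openT : fin_open [::] setT.
Proof.
split => //; last by move=> x _; exists 1.
exact: (@measurableT _ (g_sigma_algebraType _)).
Qed.

Lemma fin_open_eval (i : 'I_n) (t : R) (B : set R) : 0 <= t -> open B ->
  fin_open [:: t] [set x : path | B (x i t)].
Proof.
move=> t0 oB; split.
- by move=> u; rewrite inE => /eqP ->.
- apply: sub_sigma_algebra; exists i, t, B; split => //; first by rewrite inE.
  exact: open_measurable.
- move=> x /= Bx; have /nbhs_ballP[e e0 eB] := open_nbhs_nbhs (conj oB Bx).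
  exists e => // y hy; apply: eB; rewrite /ball/= distrC.
  by apply: hy; rewrite inE.
Qed.

(** The class to which the entropy inequality extends by monotone limits. Stability under countable
    unions and finite intersections is what the regularity proof asks of it. *)
Definition path_open U := exists C : nat -> set path,
  [/\ forall k, exists S, fin_open S (C k),
      {homo C : i j / (i <= j)%N >-> i `<=` j} & U = \bigcup_k C k].

Lemma fin_path_open S U : fin_open S U -> path_open U.
Proof.
move=> oU; exists (fun=> U); split; [by exists S|by move=> i j _ x|].
by apply/seteqP; split => x; [exists 0%N|move=> []].
Qed.

Lemma path_openI U V : path_open U -> path_open V -> path_open (U `&` V).
Proof.
move=> [C [oC ndC ->]] [D [oD ndD ->]]; exists (fun k => C k `&` D k); split.
- move=> k; have [S oS] := oC k; have [S' oS'] := oD k.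
  by exists (S ++ S'); exact: fin_openI.
- by move=> i j ij x [/(ndC _ _ ij) ? /(ndD _ _ ij)].
- apply/seteqP; split => x.
    move=> [[i _ Ci] [j _ Dj]]; exists (maxn i j) => //; split.
      exact: (ndC _ _ (leq_maxl i j)).
    exact: (ndD _ _ (leq_maxr i j)).
  by move=> [k _ [Ck Dk]]; split; exists k.
Qed.

Lemma path_open_bigcup (U : nat -> set path) :
  (forall k, path_open (U k)) -> path_open (\bigcup_k U k).
Proof.
(* Diagonal exhaustion: the [m]-th set is a finite union, hence involves finitely many times, and it
   grows with [m] in both indices. *)
move=> /choice[C hC]; exists (fun m => \big[setU/set0]_(k < m) C k m); split.
- move=> m; elim/big_ind : _ => [|A B [S oS] [S' oS']|k _].
  + by exists [::]; exact: fin_open0.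
  + by exists (S ++ S'); exact: fin_openU.
  + by have [oC _ _] := hC k.
- move=> i j ij x /=; rewrite -!(bigcup_mkord _ (fun k => C k _)) => -[k /= ki Ckx]; exists k => /=.
    exact: leq_trans ki ij.
  by have [_ ndC _] := hC k; exact: (ndC _ _ ij).
- apply/seteqP; split => x.
    move=> [k _]; have [_ ndC ->] := hC k => -[m _ Cx].
    exists (maxn k.+1 m) => //=; rewrite -(bigcup_mkord _ (fun k => C k _)); exists k => /=.
      exact: leq_maxl.
    exact: (ndC _ _ (leq_maxr k.+1 m)).
  move=> [m _] /=; rewrite -(bigcup_mkord _ (fun k => C k _)) => -[k _ Cx]; exists k => //.
  by have [_ _ ->] := hC k; exists m.
Qed.

Lemma path_open_bigcap (V : nat -> set path) N :
  (forall k, path_open (V k)) -> path_open (\big[setI/setT]_(k < N) V k).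
Proof.
move=> oV; elim/big_ind : _ => [|A B|k _ //]; last exact: path_openI.
exact: fin_path_open fin_openT.
Qed.

Lemma fin_sigma_measurable S U : {in S, forall t, 0 <= t} ->
  fin_sigma S U -> path_measurable U.
Proof.
move=> S0; apply: sub_sigma_algebra2 => _ [i [t [B [tS mB ->]]]].
by exists i, t, B; split => //; exact: S0.
Qed.

Lemma path_open_measurable U : path_open U -> path_measurable U.
Proof.
move=> [C [oC _ ->]]; apply: sigma_algebra_bigcup => k.
by have [S [S0 sU _]] := oC k; exact: fin_sigma_measurable sU.
Qed.

End open_cylinders.

Section regularity.
Context {R : realType} {d0 : measure_display} {Omega : measurableType d0}
  (n : nat) (P : probability Omega R) (X : Omega -> 'I_n -> R -> R).
Hypothesis mX : forall A, path_measurable A -> measurable (X @^-1` A).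
Local Notation path := ('I_n -> R -> R).

(** The complement of [V] plays the closed set inside [A], and that of [Q] the one inside the
    complement of [A]. This symmetry makes stability under complements immediate. *)
Definition regular (A : set path) := forall e : R, 0 < e -> exists Q V,
  [/\ path_open Q, path_open V, A `<=` Q, ~` A `<=` V &
      fine (P (X @^-1` (Q `&` V))) <= e].

Lemma measurable_path_open Q : path_open Q -> measurable (X @^-1` Q).
Proof. by move=> oO; apply: mX; exact: path_open_measurable. Qed.

(** A countable intersection of the [V k] need not be open, so only [N] of them are kept, with [N]
    such that the first [N] sets [Q k] nearly exhaust their union in probability. The remainder
    costs [e / 2], the overlaps of the kept pairs the other half. *)
Lemma regular_bigcup (A : nat -> set path) :
  (forall k, regular (A k)) -> regular (\bigcup_k A k).
Proof.
move=> rA e e0.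
(* Summed over all [k], these tolerances give [e / 2]. *)
have pe k : 0 < e / 2 ^+ k.+2 by rewrite divr_gt0// exprn_gt0.
have /choice[OV hOV] : forall k, exists OV : set path * set path,
  [/\ path_open OV.1, path_open OV.2, A k `<=` OV.1, ~` A k `<=` OV.2 &
      fine (P (X @^-1` (OV.1 `&` OV.2))) <= e / 2 ^+ k.+2].
  by move=> k; have [Q [V h]] := rA k _ (pe k); exists (Q, V).
pose Q k := (OV k).1; pose V k := (OV k).2.
have oO k : path_open (Q k) by have [] := hOV k.
have oV k : path_open (V k) by have [] := hOV k.
pose ON N := \big[setU/set0]_(k < N) Q k.
have mO k : measurable (X @^-1` Q k) by exact: measurable_path_open.
have mV k : measurable (X @^-1` V k) by exact: measurable_path_open.
have ONE N : X @^-1` ON N = \big[setU/set0]_(k < N) (X @^-1` Q k).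
  by rewrite /ON -(bigcup_mkord _ Q) preimage_bigcup (bigcup_mkord _ (fun k => X @^-1` Q k)).
have mON N : measurable (X @^-1` ON N).
  by rewrite ONE; apply: bigsetU_measurable => k _; exact: mO.
have UO : X @^-1` (\bigcup_k Q k) = \bigcup_N (X @^-1` ON N).
  apply/seteqP; split => w.
    by move=> [k _ Okw]; exists k.+1 => //; rewrite /ON/= -bigcup_mkord; exists k => /=.
  by move=> [N _]; rewrite /ON/= -bigcup_mkord => -[k _ Okw]; exists k.
have ndON : {homo (fun N => X @^-1` ON N) : i j / (i <= j)%N >-> i `<=` j}.
  move=> i j ij w; rewrite /ON/= -!bigcup_mkord => -[k /= ki Okw].
  by exists k => //=; exact: leq_trans ki ij.
have [N hN] := prob_bigcup_approx P mON ndON (divr_gt0 e0 (ltr0n _ 2)).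
exists (\bigcup_k Q k), (\big[setI/setT]_(k < N) V k); split.
- exact: path_open_bigcup.
- exact: path_open_bigcap.
- by move=> x [k _ Ax]; exists k => //; have [_ _ + _ _] := hOV k; apply.
- move=> x nA; rewrite -bigcap_mkord => k /= _; have [_ _ _ + _] := hOV k; apply.
  by move=> Akx; apply: nA; exists k.
pose D := X @^-1` (\bigcup_k Q k) `\` X @^-1` ON N.
pose E := \big[setU/set0]_(k < N) (X @^-1` (Q k `&` V k)).
have mOU : measurable (X @^-1` (\bigcup_k Q k)).
  by rewrite UO; exact: bigcupT_measurable.
have mOVk k : measurable (X @^-1` (Q k `&` V k)).
  by rewrite preimage_setI; exact: measurableI.
have mD : measurable D by exact: measurableD.
have mE : measurable E by apply: bigsetU_measurable => k _; exact: mOVk.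
have mOV : measurable (X @^-1` (\bigcup_k Q k `&` \big[setI/setT]_(k < N) V k)).
  rewrite preimage_setI; apply: measurableI => //; apply: measurable_path_open.
  exact: path_open_bigcap.
have sub : X @^-1` (\bigcup_k Q k `&` \big[setI/setT]_(k < N) V k) `<=` D `|` E.
  move=> w [OUw Vw].
  have [ONw|nONw] := pselect (ON N (X w)); last by left.
  right; move: ONw; rewrite /ON -(bigcup_mkord _ Q) => -[k /= kN Qkw].
  rewrite /E -(bigcup_mkord _ (fun k => X @^-1` (Q k `&` V k))); exists k => //; split => //.
  by move: Vw; rewrite -(bigcap_mkord _ V); apply.
have PD : fine (P D) <= e / 2.
  have : fine (P (X @^-1` (\bigcup_k Q k))) = fine (P (X @^-1` ON N)) + fine (P D).
    rewrite -fineD ?fin_num_prob//; congr fine.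
    rewrite -measureU//; last by rewrite /D setDE setICA setICr setI0.
    by congr (P _); rewrite /D setDUK// UO => w ONw; exists N.
  by move=> eqD; move: hN; rewrite -UO eqD; lra.
have PE : fine (P E) <= e / 2.
  suff h m : fine (P (\big[setU/set0]_(k < m) (X @^-1` (Q k `&` V k)))) <=
      e / 2 * (1 - 2 ^- m).
    apply: le_trans (h N) _; rewrite -[leRHS]mulr1; apply: ler_wpM2l; first by lra.
    by rewrite gerBl invr_ge0 exprn_ge0.
  elim: m => [|m IH]; first by rewrite big_ord0 measure0 expr0 invr1 subrr mulr0.
  rewrite big_ord_recr/=.
  apply: le_trans (prob_setU_le P _ _) _; [|exact: mOVk|].
    by apply: bigsetU_measurable => k _; exact: mOVk.
  have [_ _ _ _ hm] := hOV m.
  apply: le_trans (lerD IH hm) _.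
  have : (2 : R) ^+ m != 0 by rewrite expf_neq0.
  move=> ne; rewrite !exprS le_eqVlt; apply/orP; left; apply/eqP; field.
  by rewrite ne.
apply: le_trans (le_prob P mOV (measurableU _ _ mD mE) sub) _.
apply: le_trans (prob_setU_le P mD mE) _; lra.
Qed.

Lemma regular_setC A : regular A -> regular (~` A).
Proof.
move=> rA e /rA[Q [V [oO oV AO AV OV]]]; exists V, Q; split => //.
  by rewrite setCK.
by rewrite setIC.
Qed.

Lemma regular_set0 : regular set0.
Proof.
move=> e e0; exists set0, setT; split => //.
- exact: (fin_path_open (fin_open0 n)).
- exact: (fin_path_open (fin_openT n)).
- by rewrite set0I preimage_set0 measure0 ltW.
Qed.

(** The open rays below [c + 1 / (m + 1)] cover the complement, and their overlap with the ray above
    [c] decreases to the empty set. *)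
Lemma regular_ray (i : 'I_n) (t c : R) : 0 <= t -> regular [set x | `]c, +oo[%classic (x i t)].
Proof.
move=> t0 e e0.
pose Q : set path := [set x | `]c, +oo[%classic (x i t)].
pose V m : set path := [set x | `]-oo, c + m.+1%:R^-1[%classic (x i t)].
have oO : path_open Q by apply: fin_path_open (fin_open_eval i t0 _); exact: interval_open.
have oV m : path_open (V m) by apply: fin_path_open (fin_open_eval i t0 _); exact: interval_open.
have mOV m : measurable (X @^-1` (Q `&` V m)).
  by apply: measurable_path_open; exact: path_openI.
(* Complements, so that continuity along increasing unions applies. *)
pose G m := ~` (X @^-1` (Q `&` V m)).
have mG m : measurable (G m) by exact: measurableC.
have ndG : {homo G : j k / (j <= k)%N >-> j `<=` k}.
  move=> j k jk w; apply: contra_not => -[Ow Vw]; split => //.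
  move: Vw; rewrite /V/= !in_itv/= => /lt_le_trans; apply.
  by rewrite lerD2l lef_pV2 ?posrE// ler_nat.
have UG : \bigcup_m G m = setT.
  apply/seteqP; split => // w _.
  have [cX|Xc] := ltP c (X w i t); last first.
    by exists 0%N => // -[]; rewrite /Q/= in_itv/= andbT ltNge Xc.
  have [m hm] : exists m : nat, c + m.+1%:R^-1 < X w i t.
    exists (Num.truncn (X w i t - c)^-1).
    rewrite -ltrBrDl -[ltRHS]invrK ltf_pV2 ?posrE ?invr_gt0 ?subr_gt0//.
    exact: truncnS_gt.
  exists m => // -[_]; rewrite /V/= in_itv/= => h.
  by move: (lt_trans h hm); rewrite ltxx.
have [m] := prob_bigcup_approx P mG ndG e0.
rewrite UG probability_setT/= /G prob_setC// => hm.
exists Q, (V m); split => //; last by lra.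
move=> x; rewrite /V/= !in_itv/= andbT => /negP; rewrite -leNgt => xc.
by apply: le_lt_trans xc _; rewrite ltrDl invr_gt0.
Qed.

(** Regular sets form a sigma-algebra, so evaluations need be tested only on open rays, which
    generate the Borel sets. *)
Lemma path_measurable_regular A : path_measurable A -> regular A.
Proof.
move: A; apply: smallest_sub.
  split; first exact: regular_set0.
    by move=> A rA; rewrite setTD; exact: regular_setC.
  exact: regular_bigcup.
move=> _ [i [t [U [t0 mU ->]]]].
have mU' : (@RGenOInfty.G R).-sigma.-measurable U by rewrite -RGenOInfty.measurableE.
have {mU mU'} : <<s (@RGenOInfty.G R) >> U by exact: mU'.
move: U; apply: smallest_sub.
  split.
  - exact: regular_set0.
  - by move=> A rA; rewrite setTD; exact: (regular_setC rA).
  - move=> A rA.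
    suff -> : [set x : path | (\bigcup_k A k) (x i t)] = \bigcup_k [set x | A k (x i t)].
      exact: regular_bigcup.
    by [].
by move=> _ [c ->]; exact: regular_ray.
Qed.

Lemma path_measurable_outer A (e : R) : path_measurable A -> 0 < e ->
  exists Q, [/\ path_open Q, A `<=` Q & fine (P (X @^-1` Q)) <= fine (P (X @^-1` A)) + e].
Proof.
move=> mA e0; have [Q [V [oO oV AO AV OV]]] := path_measurable_regular mA e0.
exists Q; split => //.
have mO := measurable_path_open oO; have mV := measurable_path_open oV.
have mOV : measurable (X @^-1` (Q `&` V)) by rewrite preimage_setI; exact: measurableI.
apply: (@le_trans _ _ (fine (P (X @^-1` A `|` X @^-1` (Q `&` V))))).
  apply: le_prob => //; first by apply: measurableU => //; exact: mX.
  move=> w Ow; have [Aw|nAw] := pselect (A (X w)); first by left.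
  by right; split => //; exact: AV.
apply: le_trans (prob_setU_le P (mX mA) mOV) _; by rewrite lerD2l.
Qed.

End regularity.

(** * Entropy inequality for the drifted process *)

Section path_entropy.
Context {R : realType} {d0 : measure_display} {Omega : measurableType d0}
  (n : nat) (P : probability Omega R) (F : R -> set (set Omega))
  (W beta : 'I_n -> R -> Omega -> R).
Hypotheses (filF : filtration F) (WW : is_Wiener P F W) (pb : prog_measurable F beta).
Local Notation xi := (xi_of beta W).

Lemma measurable_path_preimage (X : Omega -> 'I_n -> R -> R) :
  (forall i t, 0 <= t -> measurable_fun setT (fun w => X w i t)) ->
  forall A, path_measurable A -> measurable (X @^-1` A).
Proof.
move=> mX; apply: smallest_sub.
  split.
  - by rewrite /mkset preimage_set0.
  - by move=> A mA; rewrite /mkset setTD preimage_setC; exact: measurableC.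
  - by move=> A mA; rewrite /mkset preimage_bigcup; exact: bigcupT_measurable.
move=> _ [i [t [U [t0 mU ->]]]].
by have := mX i t t0 measurableT U mU; rewrite setTI.
Qed.

Lemma measurable_W A : path_measurable A -> measurable (path_of W @^-1` A).
Proof.
apply: measurable_path_preimage => i t t0 _ U mU; rewrite setTI.
have [_ mF _] := filF; have [adW _ _ _] := WW.
by apply: (mF t t0); exact: adW.
Qed.

Lemma measurable_xi A : path_measurable A -> measurable (xi @^-1` A).
Proof.
apply: measurable_path_preimage => i t t0; have [sF mF _] := filF.
apply: measurable_funD; last first.
  move=> _ U mU; rewrite setTI; have [adW _ _ _] := WW.
  by apply: (mF t t0); exact: adW.
have := measurable_time_integralR filF pb i t0 (measurable_itv `[0, t]) (@subset_refl _ _).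
move=> /(measurable_fun_g_sigma _ (sF t t0)) mI _ U mU; rewrite setTI.
by apply: (mF t t0); exact: mI.
Qed.

Definition bounded_energy (K : R) : set Omega := [set w | (total_energy beta w <= K%:E)%E].

Lemma measurable_bounded_energy K : measurable (bounded_energy K).
Proof.
rewrite (_ : bounded_energy K = total_energy beta @^-1` `]-oo, K%:E]%classic).
  exact: (measurable_preimageT (measurable_total_energy filF pb) (emeasurable_itv _)).
by apply/seteqP; split => w; rewrite /bounded_energy/= in_itv/=.
Qed.

(** When [xi] lies in the open set [U] and the energy is at most [K], the approximations lie in [U]
    from some random index on. [G m] is the event that this index is at most [m]; it is contained in
    the event for the single approximation [y m], to which the discrete inequality applies. *)
Lemma entropy_fin_open S U (K a D : R) : fin_open S U -> 0 < K -> 0 < a ->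
  (\int[P]_w mine K%:E (total_energy beta w) <= D%:E)%E ->
  a * fine (P (xi @^-1` U `&` bounded_energy K)) <=
  D / 2 + ln (1 + fine (P (path_of W @^-1` U)) * (expR a - 1)).
Proof.
move=> [S0 sU oU] K0 a0 DE.
set B := (leRHS).
have mU : path_measurable U by exact: fin_sigma_measurable sU.
have inv0 m : 0 < m.+1%:R^-1 :> R by rewrite invr_gt0.
have /choice[y hy] := fun m : nat => delayed_approximation filF WW pb K0 (inv0 m) S0.
pose G m := (xi @^-1` U `&` bounded_energy K) `&`
  \bigcap_(j in [set j | (m <= j)%N]) (y j @^-1` U).
have my j : measurable (y j @^-1` U) by have [/(_ U sU)[]] := hy j.
have mG m : measurable (G m).
  apply: measurableI.
    by apply: measurableI; [exact: measurable_xi|exact: measurable_bounded_energy].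
  by apply: bigcap_measurable => [|j _ //]; exists m => /=.
have ndG : {homo G : i j / (i <= j)%N >-> i `<=` j}.
  move=> i j ij w [Lw hw]; split => // k /= jk.
  by apply: hw => /=; exact: leq_trans ij jk.
have -> : xi @^-1` U `&` bounded_energy K = \bigcup_m G m.
  apply/seteqP; split => [w Lw|w [m _ []//]].
  have [Uw Ew] := Lw; have [e e0 eU] := oU _ Uw.
  (* From this index on, the error [1 / (j + 1)] is below the radius [e]. *)
  exists (Num.truncn e^-1) => //; split => // j /= ej.
  apply: eU => i t tS; have [_ /(_ w Ew i t tS)] := hy j.
  move=> /le_lt_trans; apply.
  rewrite -[ltRHS]invrK ltf_pV2 ?posrE ?invr_gt0//.
  by apply: lt_le_trans (truncnS_gt _) _; rewrite ler_nat.
rewrite mulrC -ler_pdivlMr//; apply: prob_bigcup_le => // m.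
rewrite ler_pdivlMr// mulrC.
apply: (@le_trans _ _ (a * fine (P (y m @^-1` U)))).
  rewrite ler_pM2l//; apply: le_prob => // w [_ hw].
  by apply: (hw m) => /=.
by have [/(_ U sU)[_ h] _] := hy m; apply: h => //; exact: ltW.
Qed.

Lemma entropy_path A (K a D : R) : path_measurable A -> 0 < K -> 0 < a ->
  (\int[P]_w mine K%:E (total_energy beta w) <= D%:E)%E ->
  a * (fine (P (xi @^-1` A)) - fine (P (~` bounded_energy K))) <=
  D / 2 + ln (1 + fine (P (path_of W @^-1` A)) * (expR a - 1)).
Proof.
move=> mA K0 a0 DE; apply/ler_addgt0Pr => e e0.
set q := fine (P (path_of W @^-1` A)).
have E0 : 0 < expR a - 1 by rewrite subr_gt0 expR_gt1.
(* Allowed excess of the [W]-probability of [Q]: multiplied by [expR a - 1] it adds [e] inside the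
   logarithm. *)
have ea0 : 0 < e / (expR a - 1) by rewrite divr_gt0.
have [Q [oQ AQ qQ]] := path_measurable_outer P measurable_W mA ea0.
have mQ := path_open_measurable oQ.
have mB := measurable_bounded_energy K.
have q0 : 0 <= q by exact: prob_ge0.
have x1 : 1 <= 1 + q * (expR a - 1) by rewrite lerDl mulr_ge0// ltW.
apply: (@le_trans _ _ (a * fine (P (xi @^-1` Q `&` bounded_energy K)))).
  rewrite ler_pM2l// lerBlDr.
  have mQB : measurable (xi @^-1` Q `&` bounded_energy K).
    by apply: measurableI => //; exact: measurable_xi.
  have mBC : measurable (~` bounded_energy K) by exact: measurableC.
  apply: le_trans (prob_setU_le P mQB mBC); apply: le_prob => //.
  - exact: measurable_xi.
  - exact: measurableU.
  - move=> w Aw; have [Bw|nBw] := pselect (bounded_energy K w); last by right.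
    by left; split => //; exact: AQ.
apply: (@le_trans _ _ (D / 2 + ln (1 + fine (P (path_of W @^-1` Q)) * (expR a - 1)))).
  have [C [oC ndC QC]] := oQ.
  have mC k : path_measurable (C k).
    by have [S [S0 sC _]] := oC k; exact: fin_sigma_measurable sC.
  have -> : xi @^-1` Q `&` bounded_energy K =
      \bigcup_k (xi @^-1` (C k) `&` bounded_energy K).
    rewrite QC; apply/seteqP; split => [w [[k _ Ck] Bw]|w [k _ [Ck Bw]]].
      by exists k.
    by split => //; exists k.
  rewrite mulrC -ler_pdivlMr//; apply: prob_bigcup_le.
  - by move=> k; apply: measurableI => //; exact: measurable_xi.
  - by move=> i j ij w [Cw Bw]; split => //; exact: (ndC _ _ ij).
  - move=> k; rewrite ler_pdivlMr// mulrC; have [S oS] := oC k.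
    apply: le_trans (entropy_fin_open oS K0 a0 DE) _; rewrite lerD2l.
    rewrite ler_ln ?posrE; last 2 first.
    + by rewrite ltr_pwDl// mulr_ge0 ?prob_ge0// ltW.
    + by rewrite ltr_pwDl// mulr_ge0 ?prob_ge0// ltW.
    rewrite lerD2l ler_pM2r//; apply: le_prob; [exact: measurable_W|exact: measurable_W|].
    by rewrite QC => w Cw; exists k.
rewrite -addrA lerD2l.
have x0 : 0 < 1 + q * (expR a - 1) by exact: lt_le_trans x1.
(* Since [x + e <= x (1 + e)] for [x >= 1], the [e] inside the logarithm costs at most [e]
   outside. *)
apply: (@le_trans _ _ (ln ((1 + q * (expR a - 1)) * (1 + e)))); last first.
  rewrite lnM ?posrE//; last by rewrite addr_gt0.
  rewrite lerD2l; apply: le_ln1Dx; exact: lt_trans e0.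
rewrite ler_ln ?posrE; last 2 first.
- by rewrite ltr_pwDl// mulr_ge0 ?prob_ge0// ltW.
- by rewrite mulr_gt0// addr_gt0.
apply: (@le_trans _ _ (1 + (q + e / (expR a - 1)) * (expR a - 1))).
  by rewrite lerD2l ler_pM2r.
rewrite (_ : (q + e / (expR a - 1)) * (expR a - 1) = q * (expR a - 1) + e).
  have := mulr_ge0 (mulr_ge0 q0 (ltW E0)) (ltW e0); move: (q * (expR a - 1)) => z.
  by nra.
by rewrite mulrDl divfK// gt_eqF.
Qed.

End path_entropy.

(** * Scalar inequalities *)

Section hoeffding.
Context {R : realType}.
Implicit Types (a q x : R).

Lemma derive_ge0_le (f df : R -> R) : (forall x, is_derive x (1 : R) f (df x)) ->
  (forall x, 0 <= x -> 0 <= df x) -> forall x, 0 <= x -> f 0 <= f x.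
Proof.
move=> fd df0 x x0.
have [|c] := @MVT_segment R f df 0 x x0 (fun z _ => fd z).
  by apply: derivable_within_continuous => z _; exact: ex_derive.
rewrite in_itv/= => /andP[c0 _]; rewrite subr0 => E.
by rewrite -subr_ge0 E mulr_ge0// df0.
Qed.

(* Hoeffding's lemma for a Bernoulli variable: the second derivative of the
   log-moment generating function is a Bernoulli variance, hence at most 1/4. *)
Lemma bernoulli_hoeffding q a : 0 <= q <= 1 -> 0 <= a ->
  ln (1 + q * (expR a - 1)) <= a * q + a ^+ 2 / 8.
Proof.
move=> /andP[q0 q1] a0.
pose v : R -> R := cst 1 + q *: (expR - cst 1).
have vE x : v x = 1 - q + q * expR x.
  by rewrite /v; change (1 + q * (expR x - 1) = 1 - q + q * expR x); ring.
have v0 x : 0 < v x.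
  rewrite vE; have e0 := expR_gt0 x; move: q0; rewrite le_eqVlt => /predU1P[<-|q0].
    by rewrite mul0r; lra.
  by have := mulr_gt0 q0 e0; lra.
have dv x : is_derive x (1 : R) v (q * expR x).
  by apply: is_derive_eq; rewrite /= subr0 add0r.
have dV x : is_derive x (1 : R) (fun y => (v y)^-1) (- (v x) ^- 2 *: (q * expR x)).
  by apply: is_deriveV; rewrite gt_eqF.
have dl x : is_derive x (1 : R) (@ln R \o v) ((v x)^-1 * (q * expR x)).
  by apply: is_derive1_comp; exact: is_derive1_ln.
(* [g] is the derivative [q + x / 4 - v' / v] of [h] below, rewritten with [v' = v - (1 - q)] so
   that only [1 / v] remains to be differentiated. *)
pose g : R -> R := cst (q - 1) + 4^-1 *: (@id R) + (1 - q) *: (fun y => (v y)^-1).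
pose dg x := 4^-1 - (1 - q) * (q * expR x) / (v x) ^+ 2.
have gd x : is_derive x (1 : R) g (dg x).
  apply: is_derive_eq; rewrite /dg.
  change (0 + 4^-1 * 1 + (1 - q) * (- (v x) ^- 2 * (q * expR x)) =
          4^-1 - (1 - q) * (q * expR x) / (v x) ^+ 2).
  by field; rewrite gt_eqF.
have gE x : g x = q + x / 4 - (v x)^-1 * (q * expR x).
  change (q - 1 + 4^-1 * x + (1 - q) * (v x)^-1 = q + x / 4 - (v x)^-1 * (q * expR x)).
  have -> : q * expR x = v x - (1 - q) by rewrite vE; ring.
  by field; rewrite gt_eqF.
have g0 x : 0 <= x -> 0 <= g x.
  move=> x0; have g00 : g 0 = 0 by rewrite gE vE expR0 mulr1 subrK invr1; lra.
  rewrite -g00; apply: (derive_ge0_le gd) => // z _; rewrite /dg subr_ge0.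
  (* The variance bound, in the form [4 (1 - q) w <= (1 - q + w)^2] with [w = q e^z]. *)
  rewrite ler_pdivrMr ?exprn_gt0// vE.
  have := sqr_ge0 (1 - q - q * expR z); move: (q * expR z) => w; nra.
pose h : R -> R := q *: (@id R) + 8^-1 *: ((@id R) * (@id R)) - (@ln R \o v).
have hd x : is_derive x (1 : R) h (g x).
  apply: is_derive_eq; rewrite gE.
  change (q * 1 + 8^-1 * (x * 1 + x * 1) - (v x)^-1 * (q * expR x) =
          q + x / 4 - (v x)^-1 * (q * expR x)).
  by field; rewrite gt_eqF.
have : q * 0 + 8^-1 * (0 * 0) - ln (v 0) <= q * a + 8^-1 * (a * a) - ln (v a).
  exact: (derive_ge0_le hd g0 a0).
rewrite !vE expR0 mulr1 subrK ln1.
have -> : 1 + q * (expR a - 1) = 1 - q + q * expR a by ring.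
by move: (ln _) => l; rewrite !mulr0 expr2; lra.
Qed.

End hoeffding.

(** * The three bounds from the entropy inequality *)

Section numeric_bounds.
Context {R : realType} (p q M delta : R).
Hypotheses (p01 : 0 <= p <= 1) (q01 : 0 <= q <= 1) (M0 : 0 <= M) (d01 : 0 < delta < 1).
Hypothesis H : forall K a, 0 < K -> 0 < a ->
  a * (p - M / powR K delta) <=
  powR K (1 - delta) * M / 2 + ln (1 + q * (expR a - 1)).

Lemma powR1B (x : R) : 0 < x -> powR x (1 - delta) = x / powR x delta.
Proof.
by move=> x0; rewrite powRB ?powRr1 ?ltW//; apply/implyP => _; rewrite gt_eqF.
Qed.

(** [K = 2 ln N] makes the tail term and the energy term, after division by [a = ln N], both equal
    to [X]. The [ln 2] comes from [1 + q (N - 1) <= 2], valid when [q N < 1]; otherwise the bound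
    follows from [p <= 1]. *)
Lemma lower_bound (N : R) : 1 < N ->
  N^-1 * (p - powR 2 (1 - delta) * M / powR (ln N) delta - ln 2 / ln N) <= q.
Proof.
move=> N1; have N0 : 0 < N by exact: lt_trans N1.
have l0 : 0 < ln N by exact: ln_gt0.
have /andP[p0 p1] := p01; have /andP[q0 q1] := q01.
have ln20 : 0 <= ln 2 :> R by apply: ln_ge0; lra.
have l2 : 0 <= ln 2 / ln N by rewrite divr_ge0// ltW.
rewrite mulrC ler_pdivrMr//.
pose X := M / powR (2 * ln N) delta.
have pd : 0 < powR (2 * ln N) delta by rewrite powR_gt0// mulr_gt0.
have X0 : 0 <= X by rewrite divr_ge0// ltW.
have -> : powR 2 (1 - delta) * M / powR (ln N) delta = 2 * X.
  rewrite /X powR1B// powRM//; last exact: ltW.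
  have h1 : powR 2 delta != 0 :> R by rewrite gt_eqF// powR_gt0.
  have h2 : powR (ln N) delta != 0 by rewrite gt_eqF// powR_gt0.
  by field; rewrite h1 h2.
have [Nq|Nq] := leP 1 (q * N); first by lra.
have := H (K := 2 * ln N) (a := ln N) (mulr_gt0 (ltr0n _ 2) l0) l0.
rewrite lnK ?posrE// -/X powR1B ?mulr_gt0//.
have -> : 2 * ln N / powR (2 * ln N) delta * M / 2 = ln N * X.
  by rewrite /X; field; rewrite gt_eqF.
have ll : ln (1 + q * (N - 1)) <= ln 2.
  have qN : 0 <= q * (N - 1) by rewrite mulr_ge0//; lra.
  rewrite ler_ln ?posrE; [|lra..].
  by rewrite mulrBr mulr1; lra.
move=> h.
have {}h : ln N * (p - 2 * X) <= ln 2.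
  rewrite (_ : ln N * (p - 2 * X) = ln N * (p - X) - ln N * X); last by ring.
  by move: h ll; move: (ln N * (p - X)) (ln N * X) (ln (1 + _)) => x1 x2 x3; lra.
rewrite mulrC -ler_pdivlMr// in h.
have : 0 <= q * N by rewrite mulr_ge0// ltW.
by lra.
Qed.

(** The minimum is [1 / N]. Here [ln N >= y] makes the moment term at most 1/2, and [N >= 8 = 2^3]
    makes [ln 2 / ln N] at most 1/3. Their sum 5/6 leaves [q >= (p - 5/6) / N], whence
    [p - q <= 1 - 1 / (6 N)] because [p <= 1]. *)
Lemma large_deviation_bound :
  p - q <= 1 - 6^-1 * Num.min (8^-1)
    (expR (- powR (powR 2 (2 - delta) * M) (1 / delta))).
Proof.
have /andP[p0 p1] := p01; have /andP[q0 q1] := q01; have /andP[d0 d1] := d01.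
set y := powR (powR 2 (2 - delta) * M) (1 / delta).
have y0 : 0 <= y by exact: powR_ge0.
pose N := Num.max 8 (expR y).
have N8 : 8 <= N by rewrite le_max lexx.
have Ny : expR y <= N by rewrite le_max lexx orbT.
have N0 : 0 < N by exact: lt_le_trans N8.
have N1 : 1 < N by apply: lt_le_trans N8; rewrite ltr1n.
have := lower_bound N1.
have lnN : 0 < ln N by exact: ln_gt0.
have lny : y <= ln N by rewrite -[leLHS]expRK ler_ln ?posrE ?expR_gt0.
have ln8 : 3 * ln 2 <= ln N.
  rewrite (_ : 3 * ln 2 = ln 8); first by rewrite ler_ln ?posrE.
  by rewrite (_ : 8 = 2 ^+ 3) ?lnXn// ?mulr_natl//; rewrite -natrX.
have A1 : powR 2 (1 - delta) * M / powR (ln N) delta <= 2^-1.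
  rewrite ler_pdivrMr ?powR_gt0//.
  have : powR 2 (2 - delta) * M <= powR (ln N) delta.
    have -> : powR 2 (2 - delta) * M = powR y delta.
      rewrite /y -powRrM div1r mulVf ?gt_eqF// powRr1//.
      by rewrite mulr_ge0// powR_ge0.
    by apply: ge0_ler_powR; rewrite ?nnegrE// ltW.
  have -> : powR 2 (2 - delta) = 2 * powR 2 (1 - delta) :> R.
    rewrite (_ : 2 - delta = 1 + (1 - delta)); last by ring.
    by rewrite powRD ?powRr1//; apply/implyP.
  by lra.
have A2 : ln 2 / ln N <= 3^-1 by rewrite ler_pdivrMr//; lra.
move=> h.
have t1 : N^-1 <= 1 by rewrite invf_le1// ltW.
have t0 : 0 < N^-1 by rewrite invr_gt0.
have mN : Num.min 8^-1 (expR (- y)) <= N^-1.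
  rewrite expRN /N; case: (leP 8 (expR y)) => hy.
    by rewrite ge_min lexx orbT.
  by rewrite ge_min lexx.
have h2 : N^-1 * (p - 5 / 6) <= q.
  apply: le_trans h; rewrite ler_pM2l//; move: A1 A2.
  by move: (_ / powR (ln N) delta) (ln 2 / ln N) => u1 u2; lra.
move: t0 t1 mN h2; move: (N^-1) (Num.min _ _) => t m t0 t1 mN h2.
by nra.
Qed.

(** Let [z] be the square root of [K^(1-delta) M]. The chosen [K] makes [M / K^delta] equal to
    [z / 2], so the two errors add up to [z], which is the bound itself. *)
Lemma small_deviation_bound :
  p - q <= powR 2 ((1 - delta) / (1 + delta)) * powR M (1 / (1 + delta)).
Proof.
have /andP[d0 d1] := d01.
have pinsker K : 0 < K -> forall z, 0 <= z -> powR K (1 - delta) * M = z ^+ 2 ->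
    p - q <= M / powR K delta + z / 2.
  move=> K0 z z0 zE; set r := M / powR K delta.
  rewrite leNgt; apply/negP => hx.
  pose x := p - q - r.
  have x0 : z / 2 < x by rewrite /x; lra.
  have x0' : 0 < x by apply: le_lt_trans x0; rewrite divr_ge0.
  (* [a = 4 x] minimises [a^2 / 8 - a x]; what remains is [2 x^2 <= z^2 / 2]. *)
  have x40 : 0 < 4 * x by rewrite mulr_gt0.
  have := H K0 x40; have := bernoulli_hoeffding q01 (ltW x40).
  rewrite zE -/r; move: (ln _) => l h1 h2.
  have : 4 * x * (p - r) <= z ^+ 2 / 2 + (4 * x * q + (4 * x) ^+ 2 / 8) by lra.
  have -> : p - r = x + q by rewrite /x; ring.
  have : z ^+ 2 < (2 * x) ^+ 2 by rewrite ltr_pXn2r ?nnegrE//; lra.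
  by move=> h3 h4; nra.
(* For [M = 0] the general choice of [K] would be 0; [K = 1] serves instead. *)
have [M00|Mn0] := eqVneq M 0.
  have := pinsker 1 ltr01 0 (lexx 0); rewrite M00 mulr0 expr0n/= => /(_ erefl).
  by rewrite !mul0r addr0 => /le_trans; apply; rewrite mulr_ge0 ?powR_ge0.
have {Mn0}Mp : 0 < M by rewrite lt_neqAle eq_sym Mn0.
pose k : R := ln 2; pose m := ln M.
have E2 : 2 = expR k :> R by rewrite lnK ?posrE.
have EM : M = expR m by rewrite lnK ?posrE.
have d1n : 1 + delta != 0 by rewrite gt_eqF// addr_gt0.
(* [kap] and [gam] are the logarithms of [K] and of the bound, so that identities between powers
   become rational ones. *)
pose kap := (2 * k + m) / (1 + delta).
pose gam := (1 - delta) / (1 + delta) * k + m / (1 + delta).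
have -> : powR 2 ((1 - delta) / (1 + delta)) * powR M (1 / (1 + delta)) = expR gam.
  rewrite EM {1}E2 -!expRM -expRD; congr expR; rewrite /gam; ring.
have := pinsker (expR kap) (expR_gt0 _) (expR gam) (expR_ge0 _).
rewrite -!expRM; have -> : expR (kap * (1 - delta)) * M = expR gam ^+ 2.
  rewrite EM -expRD -expRM_natl; congr expR; rewrite /kap /gam; field.
  by [].
move=> /(_ erefl) /le_trans; apply.
have -> : M / expR (kap * delta) = expR gam / 2.
  rewrite {1}EM E2 -!expRN -!expRD; congr expR; rewrite /kap /gam; field.
  by [].
by lra.
Qed.

End numeric_bounds.

(** * Conclusion *)

Section energy_moments.
Context {R : realType} {d0 : measure_display} {Omega : measurableType d0}
  (n : nat) (P : probability Omega R) (F : R -> set (set Omega))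
  (beta : 'I_n -> R -> Omega -> R).
Hypotheses (filF : filtration F) (pb : prog_measurable F beta).
Variables (delta K : R).
Hypotheses (d01 : 0 < delta < 1) (K0 : 0 < K) (Moo : (Mdelta P beta delta < +oo)%E).
Local Notation M := (fine (Mdelta P beta delta)).
Local Notation E := (total_energy beta).

Lemma total_energy_ge0 w : (0 <= E w)%E.
Proof. by apply: integral_ge0 => r _; rewrite lee_fin speed2_ge0. Qed.

Lemma MdeltaE : Mdelta P beta delta = (\int[P]_w poweR (E w) delta)%E.
Proof. by []. Qed.

Lemma measurable_energy_power : measurable_fun setT (fun w => poweR (E w) delta).
Proof.
exact: (measurableT_comp (measurable_poweR delta) (measurable_total_energy filF pb)).
Qed.

Lemma Mdelta_fineK : (M%:E = \int[P]_w poweR (E w) delta)%E.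
Proof.
rewrite -MdeltaE fineK// ge0_fin_numE// MdeltaE.
by apply: integral_ge0 => w _; exact: poweR_ge0.
Qed.

(** Markov's inequality for the power [delta] of the energy. *)
Lemma prob_high_energy_le : fine (P (~` bounded_energy beta K)) <= M / powR K delta.
Proof.
have /andP[de0 de1] := d01.
have mB : measurable (~` bounded_energy beta K).
  by apply: measurableC; exact: (measurable_bounded_energy filF pb).
rewrite ler_pdivlMr ?powR_gt0// -lee_fin EFinM fineK ?fin_num_prob// Mdelta_fineK.
apply: (@le_trans _ _ (\int[P]_(w in ~` bounded_energy beta K) poweR (E w) delta)%E); last first.
  apply: ge0_subset_integral => //; first exact: measurable_energy_power.
  by move=> w _; exact: poweR_ge0.
apply: (@le_trans _ _ (\int[P]_(w in ~` bounded_energy beta K) (cst (powR K delta)%:E) w)%E).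
  by rewrite integral_cst// muleC.
apply: ge0_le_integral => //.
- by move=> w _; rewrite lee_fin powR_ge0.
- by apply: measurable_funTS; exact: measurable_energy_power.
- move=> w; rewrite /bounded_energy/= => /negP; rewrite -ltNge => KE.
  rewrite -poweR_EFin; apply: gt0_ler_poweR; first exact: ltW.
  - by rewrite in_itv/= lee_fin (ltW K0) leey.
  - by rewrite in_itv/= total_energy_ge0 leey.
  - exact: ltW.
Qed.

(** Pointwise [min(K, x) <= K^(1-delta) x^delta]: the smaller of the two numbers is split into its
    powers [1 - delta] and [delta]. *)
Lemma integral_truncated_energy_le :
  (\int[P]_w mine K%:E (E w) <= (powR K (1 - delta) * M)%:E)%E.
Proof.
have /andP[de0 de1] := d01.
have KE : K = powR K (1 - delta) * powR K delta.
  rewrite -powRD ?subrK ?powRr1 ?ltW//; apply/implyP => _; by rewrite gt_eqF.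
rewrite EFinM Mdelta_fineK -ge0_integralZl//; first last.
- by rewrite lee_fin powR_ge0.
- by move=> w _; exact: poweR_ge0.
- exact: measurable_energy_power.
apply: ge0_le_integral => //.
- by move=> w _; rewrite le_min lee_fin (ltW K0) total_energy_ge0.
- apply: measurable_mine; first exact: measurable_cst.
  exact: (measurable_total_energy filF pb).
- by apply: measurable_funeM; exact: measurable_energy_power.
move=> w _; have := total_energy_ge0 w; case: (E w) => [x| |]//= x0.
- rewrite -EFinM -EFin_min lee_fin; rewrite lee_fin in x0.
  have [xK|Kx] := leP x K.
    have xE : x = powR x (1 - delta) * powR x delta.
      have [->|xn0] := eqVneq x 0; first by rewrite [X in _ * X]powR0 ?mulr0// gt_eqF.
      by rewrite -powRD ?subrK ?powRr1//; apply/implyP.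
    rewrite [leLHS]xE; apply: ler_wpM2r; first exact: powR_ge0.
    by apply: ge0_ler_powR; rewrite ?nnegrE// ?subr_ge0 ltW.
  rewrite [leLHS]KE; apply: ler_wpM2l; first exact: powR_ge0.
  by apply: ge0_ler_powR; rewrite ?nnegrE// ltW.
- rewrite gt_eqF// gt0_muley ?leey// lte_fin powR_gt0//.
Qed.

End energy_moments.

Theorem theoremA5 (R : realType) (dO : measure_display) (Omega : measurableType dO)
  (n : nat) (P : probability Omega R) (F : R -> set (set Omega))
  (W beta : 'I_n -> R -> Omega -> R) :
  filtration F ->
  is_Wiener P F W ->
  prog_measurable F beta ->
  (forall t : R, 0 <= t -> {ae P, forall omega,
     (\int[lebesgue_measure]_(s in `[0%R, t]%classic)
        (Num.sqrt (\sum_(i < n) beta i s omega ^+ 2))%:E < +oo)%E}) ->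
  forall delta : R, 0 < delta < 1 ->
  (Mdelta P beta delta < +oo)%E ->
  let M := fine (Mdelta P beta delta) in
  let mu_xi := fun A => fine (P (xi_of beta W @^-1` A)) in
  let mu_W := fun A => fine (P (path_of W @^-1` A)) in
  [/\ (dTV P (xi_of beta W) (path_of W) <=
         (powR 2 ((1 - delta) / (1 + delta)) * powR M (1 / (1 + delta)))%:E)%E,
      (dTV P (xi_of beta W) (path_of W) <=
         (1 - 6^-1 * Num.min (8^-1) (expR (- powR (powR 2 (2 - delta) * M) (1 / delta))))%:E)%E
    & forall A, @path_measurable R n A -> forall N : R, 1 < N ->
        mu_W A >= N^-1 * (mu_xi A - powR 2 (1 - delta) * M / powR (ln N) delta
                           - ln 2 / ln N)].
Proof.
move=> filF WW pb _ delta d01 Moo M mu_xi mu_W.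
have M0 : 0 <= M by apply: fine_ge0; apply: integral_ge0 => w _; exact: poweR_ge0.
have mx A : path_measurable A -> measurable (xi_of beta W @^-1` A).
  exact: (measurable_xi filF WW pb).
have mw A : path_measurable A -> measurable (path_of W @^-1` A).
  exact: (measurable_W filF WW).
have p01 A : path_measurable A -> 0 <= mu_xi A <= 1.
  by move=> mA; rewrite /mu_xi prob_ge0 prob_le1//; exact: mx.
have q01 A : path_measurable A -> 0 <= mu_W A <= 1.
  by move=> mA; rewrite /mu_W prob_ge0 prob_le1//; exact: mw.
have H A : path_measurable A -> forall K a, 0 < K -> 0 < a ->
    a * (mu_xi A - M / powR K delta) <=
    powR K (1 - delta) * M / 2 + ln (1 + mu_W A * (expR a - 1)).
  move=> mA K a K0 a0.
  apply: le_trans (entropy_path filF WW pb mA K0 a0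
    (integral_truncated_energy_le filF pb d01 K0 Moo)).
  by rewrite ler_pM2l// lerD2l lerN2; exact: (prob_high_energy_le filF pb d01 K0 Moo).
have mC (A : set ('I_n -> R -> R)) : path_measurable A -> path_measurable (~` A).
  by move=> mA; rewrite -setTD; exact: sigma_algebraCD.
(* Passing to the complement changes the sign of the difference, so one-sided bounds over all
   measurable sets control the absolute value. *)
have tv (c : R) : (forall A, path_measurable A -> mu_xi A - mu_W A <= c) ->
    (dTV P (xi_of beta W) (path_of W) <= c%:E)%E.
  move=> hc; apply: ge_ereal_sup => _ [A mA <-].
  have -> : (P (xi_of beta W @^-1` A) - P (path_of W @^-1` A) = (mu_xi A - mu_W A)%:E)%E.
    by rewrite EFinB !fineK// fin_num_prob//; [exact: mw|exact: mx].
  rewrite /= lee_fin ler_norml (hc A mA) andbT.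
  have mCA := mC A mA.
  have eqx : mu_xi (~` A) = 1 - mu_xi A by exact: (prob_setC P (mx A mA)).
  have eqw : mu_W (~` A) = 1 - mu_W A by exact: (prob_setC P (mw A mA)).
  have := hc (~` A) mCA; rewrite eqx eqw.
  by rewrite opprB addrCA addrAC subrr add0r lerNl opprB addrC.
split.
- by apply: tv => A mA; exact: (small_deviation_bound (q01 A mA) M0 d01 (H A mA)).
- by apply: tv => A mA; exact: (large_deviation_bound (p01 A mA) (q01 A mA) M0 d01 (H A mA)).
- by move=> A mA N N1; exact: (lower_bound (p01 A mA) (q01 A mA) M0 (H A mA)).
Qed.
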